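(* Let $n,m\ge 1$, let $g_0,\dots,g_{m-1}:\mathbb C^n\to\mathbb C$ be holomorphic functions, and let $f(z)=\sum_{j=0}^{m-1}|g_j(z)|^2$. Let $P\in\mathbb C^{n\times n}$ be an arbitrary fixed Hermitian positive definite matrix, and consider the regularized mixed Newton iteration $$z^{k+1}=T(z^k),\qquad T(z)=z-\left(\frac{\partial^2 f(z)}{\partial\bar z\,\partial z}+P\right)^{-1}\frac{\partial f(z)}{\partial\bar z}.$$ Let $\hat z\in\mathbb C^n$ be a critical point of $f$, i.e. $\frac{\partial f(\hat z)}{\partial\bar z}=0$, let $H_{\mathbb R}\in\mathbb R^{2n\times 2n}$ be the Hessian of $f$ at $\hat z$ with respect to the real coordinates $(\operatorname{Re} z,\operatorname{Im} z)$, and let $L$ be the $\mathbb R$-linear operator on $\mathbb C^n\cong\mathbb R^{2n}$ which is the real derivative of $T$ at $\hat z$, so that the iteration satisfies $z^{k+1}-\hat z=L(z^k-\hat z)+O(\|z^k-\hat z\|^2)$ for $z^k$ near $\hat z$. Then: 1. The linear dynamical system $\delta_{k+1}=L\delta_k$ is strictly stable if and only if $\hat z$ is a minimum with positive definite Hessian, i.e. $H_{\mathbb R}\succ 0$. 2. The linear dynamical system $\delta_{k+1}=L\delta_k$ has repulsive directions if and only if $\hat z$ is a saddle point, i.e. $H_{\mathbb R}$ has both positive and negative eigenvalues. 3. The case of a maximum is excluded, i.e. $H_{\mathbb R}$ cannot be negative definite.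
   Context: Derivatives with respect to $z$ and $\bar z$ are Wirtinger derivatives: with $z=x+iy$, $\frac{\partial}{\partial z}=\frac12\left(\frac{\partial}{\partial x}-i\frac{\partial}{\partial y}\right)$ and $\frac{\partial}{\partial\bar z}=\frac12\left(\frac{\partial}{\partial x}+i\frac{\partial}{\partial y}\right)$, componentwise. Writing $g_j'\in\mathbb C^n$ for the (column) vector of complex partial derivatives of $g_j$ and $g_j''\in\mathbb C^{n\times n}$ for the symmetric matrix of its second complex partial derivatives, one has for $f=\sum_j|g_j|^2$ $$\frac{\partial f}{\partial\bar z}=\sum_{j=0}^{m-1}g_j\,\overline{g_j'},\qquad \frac{\partial^2 f}{\partial\bar z\,\partial z}=\sum_{j=0}^{m-1}\overline{g_j'}\,(g_j')^\top .$$ The second matrix (the mixed Hessian) is Hermitian positive semi-definite, so its sum with $P$ is invertible and $T$ is well defined on all of $\mathbb C^n$. With $B=\sum_j\overline{g_j'(\hat z)}\,g_j'(\hat z)^\top$ and $A=\sum_j g_j(\hat z)\,\overline{g_j''(\hat z)}$, the linearization at the critical point $\hat z$ is explicitly $$L\delta=\left(I_n-(B+P)^{-1}B\right)\delta-(B+P)^{-1}A\,\bar\delta ,\qquad \delta\in\mathbb C^n .$$ Equivalently, the pair $(\delta,\bar\delta)$ evolves by the complex $2n\times 2n$ matrix $$Y=\begin{pmatrix} I_n-(B+P)^{-1}B & -(B+P)^{-1}A\\ -(\bar B+\bar P)^{-1}\bar A & I_n-(\bar B+\bar P)^{-1}\bar B\end{pmatrix},$$ and the spectrum of $L$ (as a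 real-linear operator on $\mathbb R^{2n}$, with complex eigenvalues allowed) is the spectrum of $Y$. Terminology: the linear system $\delta_{k+1}=L\delta_k$ is strictly stable if the spectrum of $L$ (equivalently of $Y$) is contained in the open unit disc, i.e. all trajectories converge to $0$. It has repulsive directions if $L$ (equivalently $Y$) has an eigenvalue of modulus strictly greater than $1$. The type of the critical point $\hat z$ is determined by the signature of $H_{\mathbb R}$: minimum (with positive definite Hessian) if $H_{\mathbb R}\succ0$, saddle point if $H_{\mathbb R}$ has both positive and negative eigenvalues, maximum if $H_{\mathbb R}$ is negative definite. *)

(* Defs.v *)
From HB Require Import structures.
From mathcomp Require Import all_boot all_order all_algebra.
From mathcomp Require Import complex.
From mathcomp Require Import all_classical all_reals all_analysis.
Export numFieldNormedType.Exports.

Set Implicit Arguments.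
Unset Strict Implicit.
Unset Printing Implicit Defensive.
Import Order.TTheory GRing.Theory Num.Theory.
Local Open Scope ring_scope.
Local Open Scope complex_scope.
Local Open Scope sesquilinear_scope.

(* C^n is the type of columns 'cV[R[i]]_n.  Its real coordinates
   (Re z, Im z) are the rows 'rV[R]_(n + n), so that the library's [jacobian]
   and [eigenvalue], which both act on row vectors, can be used as they are. *)
Definition to_real (R : realType) (n : nat) (z : 'cV[R[i]]_n) : 'rV[R]_(n + n) :=
  row_mx (\row_k complex.Re (z k 0)) (\row_k complex.Im (z k 0)).

Definition of_real (R : realType) (n : nat) (u : 'rV[R]_(n + n)) : 'cV[R[i]]_n :=
  \col_k (u 0 (lshift n k) +i* u 0 (rshift n k)).

(* Complex Frechet differentiability at every point: [differentiable] is taken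
   in normed modules over R[i]. *)
Definition holomorphic (R : realType) (n : nat) (g : 'cV[R[i]]_n -> R[i]) : Prop :=
  let C : numFieldType := R[i] in
  forall z : 'cV[C]_n, differentiable (g : 'cV[C]_n -> C^o) z.

(* Derivative at t = 0 of F (z + t w) for t real. *)
Definition real_deriv (R : realType) (n : nat) (w : 'cV[R[i]]_n)
    (F : 'cV[R[i]]_n -> R[i]) (z : 'cV[R[i]]_n) : R[i] :=
  (derive1 (fun t : R => complex.Re (F (z + t%:C *: w))) 0 : R)
    +i* (derive1 (fun t : R => complex.Im (F (z + t%:C *: w))) 0 : R).

Definition partial_x (R : realType) (n : nat) (k : 'I_n)
    (F : 'cV[R[i]]_n -> R[i]) : 'cV[R[i]]_n -> R[i] :=
  real_deriv (delta_mx k 0) F.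

Definition partial_y (R : realType) (n : nat) (k : 'I_n)
    (F : 'cV[R[i]]_n -> R[i]) : 'cV[R[i]]_n -> R[i] :=
  real_deriv ('i *: delta_mx k 0) F.

Definition dz (R : realType) (n : nat) (k : 'I_n)
    (F : 'cV[R[i]]_n -> R[i]) (z : 'cV[R[i]]_n) : R[i] :=
  2^-1 * (partial_x k F z - 'i * partial_y k F z).

Definition dzbar (R : realType) (n : nat) (k : 'I_n)
    (F : 'cV[R[i]]_n -> R[i]) (z : 'cV[R[i]]_n) : R[i] :=
  2^-1 * (partial_x k F z + 'i * partial_y k F z).

Definition sum_sq_norm (R : realType) (n m : nat) (g : 'I_m -> 'cV[R[i]]_n -> R[i])
    (z : 'cV[R[i]]_n) : R[i] :=
  \sum_(j < m) `|g j z| ^+ 2.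

Definition grad_zbar (R : realType) (n : nat) (f : 'cV[R[i]]_n -> R[i])
    (z : 'cV[R[i]]_n) : 'cV[R[i]]_n :=
  \col_k dzbar k f z.

Definition mixed_hessian (R : realType) (n : nat) (f : 'cV[R[i]]_n -> R[i])
    (z : 'cV[R[i]]_n) : 'M[R[i]]_n :=
  \matrix_(k, l) dzbar k (dz l f) z.

Definition newton_step (R : realType) (n : nat) (P : 'M[R[i]]_n)
    (f : 'cV[R[i]]_n -> R[i]) (z : 'cV[R[i]]_n) : 'cV[R[i]]_n :=
  z - invmx (mixed_hessian f z + P) *m grad_zbar f z.

Definition hermitian_posdef (R : realType) (n : nat) (P : 'M[R[i]]_n) : Prop :=
  P \is hermsymmx /\
  forall v : 'cV[R[i]]_n, v != 0 -> 0 < (v^t* *m P *m v) 0 0.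

(* f is real-valued; its real part is f seen as a function with values in R. *)
Definition real_hessian (R : realType) (n : nat) (f : 'cV[R[i]]_n -> R[i])
    (z : 'cV[R[i]]_n) : 'M[R]_(n + n) :=
  let fR (u : 'rV[R]_(n + n)) : R := complex.Re (f (of_real u)) in
  \matrix_(k, l) ('D_(delta_mx 0 k) ('D_(delta_mx 0 l) fR) (to_real z) : R).

Definition in_real_coords (R : realType) (n : nat)
    (T : 'cV[R[i]]_n -> 'cV[R[i]]_n) (u : 'rV[R]_(n + n)) : 'rV[R]_(n + n) :=
  to_real (T (of_real u)).

(* The matrix L of the real derivative, acting on rows: delta |-> delta *m L. *)
Definition linearization (R : realType) (n : nat)
    (T : 'cV[R[i]]_n -> 'cV[R[i]]_n) (z : 'cV[R[i]]_n) : 'M[R]_(n + n) :=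
  'J (in_real_coords T) (to_real z).

Definition complex_eigenvalue (R : realType) (d : nat) (L : 'M[R]_d) (a : R[i]) : Prop :=
  eigenvalue (map_mx (real_complex R) L) a.

Definition strictly_stable (R : realType) (d : nat) (L : 'M[R]_d) : Prop :=
  forall a : R[i], complex_eigenvalue L a -> `|a| < 1.

Definition has_repulsive_directions (R : realType) (d : nat) (L : 'M[R]_d) : Prop :=
  exists a : R[i], complex_eigenvalue L a /\ 1 < `|a|.

Definition posdef (R : realType) (d : nat) (H : 'M[R]_d) : Prop :=
  forall x : 'rV[R]_d, x != 0 -> 0 < (x *m H *m x^T) 0 0.

Definition negdef (R : realType) (d : nat) (H : 'M[R]_d) : Prop :=
  forall x : 'rV[R]_d, x != 0 -> (x *m H *m x^T) 0 0 < 0.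

Definition saddle (R : realType) (d : nat) (H : 'M[R]_d) : Prop :=
  (exists a : R, eigenvalue H a /\ 0 < a) /\
  (exists b : R, eigenvalue H b /\ b < 0).

(* T z = z0 + L (z - z0) + O(|z - z0|^2) near z0, in real coordinates. *)
Definition second_order_linearization (R : realType) (n : nat)
    (T : 'cV[R[i]]_n -> 'cV[R[i]]_n) (z0 : 'cV[R[i]]_n) (L : 'M[R]_(n + n)) : Prop :=
  exists C : R, \forall u \near to_real z0,
    `|in_real_coords T u - to_real z0 - (u - to_real z0) *m L|
      <= C * `|u - to_real z0| ^+ 2.

(* Main.v *)
(* Near the critical point, T z = z - K(z) G(z) with K = (B + P)^-1, G the
   conjugate gradient and G(zhat) = 0, so only the value of K at zhat and the
   differential of G matter: in real coordinates (acting on rows) the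
   linearization is L = 1 - (1/2) H S, where H is the real Hessian and S the
   realification of (B + P)^-1.  Every eigenvalue a of L is therefore 1 - r/2
   with r a generalized Rayleigh quotient of H with respect to N = S^-1, hence
   real, and H and HS have the same signs in their spectra.  Moreover
   q_H(w) + q_H(i w) = 4 w^* B w lies in [0, 4 w^* (B + P) w[; this excludes
   negative definite H, gives r < 4 when H > 0, and turns r > 4 (like r < 0)
   into a sign change of q_H.

   The expansion of T needs holomorphic functions to be smooth.  Goursat's
   theorem gives Cauchy's estimate |F'(a)| <= C M / r, applied on complex lines.
   Applied to g and to the differences g(z + h) - g(z), it bounds the second
   order Taylor remainder of g by C |h|^2 with C depending only on a local bound
   of g.  The quotients (g(z + s w) - g(z)) / s are uniformly locally bounded,
   so this uniform remainder passes to their limit: the derivative of g along w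
   is again holomorphic. *)
Require Import Defs.
From HB Require Import structures.
From mathcomp Require Import all_boot all_order all_algebra.
From mathcomp Require Import complex ring lra.
From mathcomp Require Import all_classical all_reals all_analysis.
Import Order.TTheory GRing.Theory Num.Theory.
Local Open Scope ring_scope.
Local Open Scope complex_scope.

Set Implicit Arguments.
Unset Strict Implicit.
Unset Printing Implicit Defensive.

(** * Moduli and one-dimensional integrals *)

(** The derivatives in the statement are limits with a default value where no limit exists, and the
    mixed Hessian and the Newton step use them at every point near [zhat]. Nothing can be computed
    before holomorphic functions are known to have holomorphic derivatives; hence the amount of
    complex analysis. As each [g j] is defined on all of C^n, its restriction to a complex line is
    entire, so rectangles in the plane suffice and no domains or winding numbers have to be managed.

    Estimates carry explicit constants and use the real-valued modulus [absc], because the norm of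
    [R[i]] takes its values in [R[i]].

    The factor 1/2 in L is that of the Wirtinger operators: the conjugate gradient is half the real
    gradient. The 4 is twice 2: the second derivative of |g|^2 along w contributes 2 |g'|^2, and
    adding the direction i w doubles it. At r = 4 the eigenvalue 1 - r/2 reaches -1, so this is
    exactly the constant that stability asks for. *)

Definition absc {R : realType} (z : R[i]) : R := Normc.normc z.

Section AbsC.
Context {R : realType}.
Implicit Types (z w : R[i]).

Lemma normr_absc z : `|z| = (absc z)%:C.
Proof. by rewrite normc_def; case: z. Qed.

Lemma absc_ge0 z : 0 <= absc z.
Proof. by rewrite -ler0c -normr_absc normr_ge0. Qed.

Lemma absc0 : absc (0 : R[i]) = 0.
Proof. exact: Normc.normc0. Qed.

Lemma absc_eq0 z : (absc z == 0) = (z == 0).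
Proof. by apply/eqP/eqP => [/Normc.eq0_normc //|->]; exact: absc0. Qed.

Lemma absc_gt0 z : (0 < absc z) = (z != 0).
Proof. by rewrite lt_def absc_ge0 andbT absc_eq0. Qed.

Lemma abscM z w : absc (z * w) = absc z * absc w.
Proof. exact: Normc.normcM. Qed.

Lemma abscV z : absc z^-1 = (absc z)^-1.
Proof. exact: Normc.normcV. Qed.

Lemma absc_triangle z w : absc (z + w) <= absc z + absc w.
Proof. exact: le_normcD. Qed.

Lemma abscN z : absc (- z) = absc z.
Proof. exact: normcN. Qed.

Lemma absc_triangleB z w : absc (z - w) <= absc z + absc w.
Proof. by rewrite -(abscN w) absc_triangle. Qed.

Lemma absc_conj z : absc z^* = absc z.
Proof. by case: z => a b; rewrite /absc /= sqrrN. Qed.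

Lemma absc_real (x : R) : absc x%:C = `|x|.
Proof. by rewrite /absc /= expr0n addr0 sqrtr_sqr. Qed.

Lemma absc_i : absc ('i : R[i]) = 1.
Proof. by rewrite /absc /= expr0n add0r expr1n sqrtr1. Qed.

Lemma abs_Re_le z : `|complex.Re z| <= absc z.
Proof.
case: z => a b; rewrite /absc /= -sqrtr_sqr ler_sqrt ?addr_ge0 ?sqr_ge0 //.
by rewrite lerDl sqr_ge0.
Qed.

Lemma abs_Im_le z : `|complex.Im z| <= absc z.
Proof.
case: z => a b; rewrite /absc /= -sqrtr_sqr ler_sqrt ?addr_ge0 ?sqr_ge0 //.
by rewrite lerDr sqr_ge0.
Qed.

Lemma absc_le_ReIm z : absc z <= `|complex.Re z| + `|complex.Im z|.
Proof.
rewrite {1}(complexE z) (le_trans (absc_triangle _ _)) //.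
by rewrite abscM absc_i mul1r !absc_real.
Qed.

Lemma absc_sum (I : finType) (F : I -> R[i]) :
  absc (\sum_i F i) <= \sum_i absc (F i).
Proof.
elim/big_ind2 : _ => //[|a x b y h1 h2]; first by rewrite absc0.
exact: le_trans (absc_triangle _ _) (lerD h1 h2).
Qed.

Lemma ReM z w : complex.Re (z * w) =
  complex.Re z * complex.Re w - complex.Im z * complex.Im w.
Proof. by case: z w => a b []. Qed.

Lemma ImM z w : complex.Im (z * w) =
  complex.Re z * complex.Im w + complex.Im z * complex.Re w.
Proof. by case: z w => a b []. Qed.

Lemma ReD z w : complex.Re (z + w) = complex.Re z + complex.Re w.
Proof. by case: z w => a b []. Qed.

Lemma ImD z w : complex.Im (z + w) = complex.Im z + complex.Im w.
Proof. by case: z w => a b []. Qed.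

Lemma ReN z : complex.Re (- z) = - complex.Re z.
Proof. by case: z. Qed.

Lemma ImN z : complex.Im (- z) = - complex.Im z.
Proof. by case: z. Qed.

Lemma ReB z w : complex.Re (z - w) = complex.Re z - complex.Re w.
Proof. by rewrite ReD ReN. Qed.

Lemma ImB z w : complex.Im (z - w) = complex.Im z - complex.Im w.
Proof. by rewrite ImD ImN. Qed.

Lemma complexP z w :
  complex.Re z = complex.Re w -> complex.Im z = complex.Im w -> z = w.
Proof. by case: z w => a b [c d] /= -> ->. Qed.

End AbsC.

(** * Mean value inequality and integrals over segments *)

Section MeanValue.
Context {R : realType}.
Implicit Types (f A : R -> R) (a b e : R).

Lemma mean_value_bound f (df : R -> R) a b e : a <= b ->
  (forall x, a <= x <= b -> is_derive x 1 f (df x)) ->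
  (forall x, a <= x <= b -> `|df x| <= e) -> `|f b - f a| <= e * (b - a).
Proof.
move=> ab fd dfe.
have [|x xab|c /dfe cab ->] := @MVT_segment R f df a b ab.
- by move=> x /subset_itv_oo_cc; rewrite in_itv => /fd.
- apply: derivable_within_continuous => {}x.
  by rewrite in_itv => /fd [].
- by rewrite normrM ler_pM // ger0_norm ?subr_ge0.
Qed.

(* Starting the integral at a - 1 makes the primitive differentiable at a as
   well, so that [integ] can be handled by the mean value theorem alone. *)
Definition integ f a b : R :=
  let F x := \int[lebesgue_measure]_(t in `[a - 1, x]) f t in F b - F a.

Lemma integral_derive f a x : continuous f -> a < x ->
  is_derive x 1 (fun x => \int[lebesgue_measure]_(t in `[a, x]) f t) (f x).
Proof.
move=> cf ax.
have [||d1 d2] := @continuous_FTC1_closed R f a x (x + 1) _ _ ax (cf x).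
- by rewrite ltrDl.
- by apply: continuous_compact_integrable; [exact: segment_compact|
    exact: continuous_subspaceT].
by rewrite -d2 derive1E; exact/derivableP.
Qed.

Lemma integE f A a b : continuous f -> a <= b ->
  (forall x, a <= x <= b -> is_derive x 1 A (f x)) -> integ f a b = A b - A a.
Proof.
move=> cf ab dA; apply/eqP; rewrite -subr_eq0 /integ /=.
set F := fun x : R => \int[lebesgue_measure]_(t in `[a - 1, x]) f t.
(* Two primitives of f differ by a function of zero derivative, constant by the mean value
   inequality with bound 0. *)
have dFA x : a <= x <= b -> is_derive x 1 (F \- A) (0 : R).
  move=> xab; have dFx : is_derive x 1 F (f x).
    by apply: integral_derive => //; case/andP: xab => ? _; lra.
  by have := dA _ xab => ?; rewrite -(subrr (f x)); exact: is_deriveB.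
have h0 (x : R) : a <= x <= b -> `|0 : R| <= 0 by rewrite normr0.
have := mean_value_bound ab dFA h0; rewrite mul0r normr_le0 => /eqP h.
by rewrite -[X in _ == X]h; apply/eqP; rewrite /= /F; ring.
Qed.

Lemma integ_cat f a b c : continuous f -> a <= b -> b <= c ->
  integ f a c = integ f a b + integ f b c.
Proof.
move=> cf ab bc; pose F (x : R) := \int[lebesgue_measure]_(t in `[a - 1, x]) f t.
have dF x : a <= x -> is_derive x 1 F (f x).
  by move=> ax; apply: integral_derive => //; lra.
have FE u v : a <= u -> u <= v -> integ f u v = F v - F u.
  move=> au uv; apply: integE => // x /andP[ux _].
  exact/dF/(le_trans au).
by rewrite !FE // ?(le_trans ab) //; ring.
Qed.

(** The mean value inequality is applied to the difference between a primitive of f and the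
    quadratic primitive [Q] of the affine function, which avoids any linearity or monotonicity of
    the integral. It serves both Goursat's local estimate and, with q = 0, the limit in Cauchy's
    estimate. *)
Lemma integ_affine_bound f a b e (p q : R) : continuous f -> a <= b ->
  (forall x, a <= x <= b -> `|f x - (p + q * x)| <= e) ->
  `|integ f a b - (p * (b - a) + q * (b ^+ 2 - a ^+ 2) / 2)| <= e * (b - a).
Proof.
move=> cf ab hf; pose F (x : R) := \int[lebesgue_measure]_(t in `[a - 1, x]) f t.
have dF x : a <= x <= b -> is_derive x 1 F (f x).
  by move=> /andP[ax _]; apply: integral_derive => //; lra.
pose Q : R -> R := fun x => p * x + q / 2 * x ^+ 2.
have dQ (x : R) : is_derive x 1 Q (p + q * x).
  by rewrite /Q; apply: is_derive_eq; rewrite /GRing.scale /=; field.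
rewrite (integE cf ab dF).
have -> : F b - F a - (p * (b - a) + q * (b ^+ 2 - a ^+ 2) / 2) =
    (F \- Q) b - (F \- Q) a by rewrite /Q /=; field.
apply: (@mean_value_bound _ (fun x => f x - (p + q * x))) => // x xab.
by have := dF _ xab => ?; apply: is_deriveB.
Qed.

Lemma integ_bound f a b e : continuous f -> a <= b ->
  (forall x, a <= x <= b -> `|f x| <= e) -> `|integ f a b| <= e * (b - a).
Proof.
move=> cf ab hf; have := @integ_affine_bound f a b e 0 0 cf ab.
rewrite !mul0r add0r subr0; apply=> x /hf.
by rewrite mul0r addr0 subr0.
Qed.

End MeanValue.

(** * Goursat's theorem for rectangles *)

Section Goursat.
Context {R : realType}.
Implicit Types (E : R[i] -> R[i]) (z k : R[i]) (a b c d e : R).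

(** An epsilon form with real radii; having [absc h] on the right instead of a quotient makes h = 0
    harmless. *)
Definition has_cderiv E z k := forall e, 0 < e ->
  exists2 r, 0 < r & forall h, absc h < r ->
    absc (E (z + h) - E z - k * h) <= e * absc h.

Lemma has_cderiv_cont E z k e : has_cderiv E z k -> 0 < e ->
  exists2 r, 0 < r & forall h, absc h < r -> absc (E (z + h) - E z) < e.
Proof.
move=> /(_ 1 ltr01)[r r0 hr] e0; pose m := 1 + absc k.
have m0 : 0 < m by rewrite ltr_pwDl ?absc_ge0.
exists (Num.min r (e / m)) => [|h]; first by rewrite lt_min r0 divr_gt0.
rewrite lt_min => /andP[/hr]; rewrite mul1r ltr_pdivlMr // => h1 h2.
have -> : E (z + h) - E z = (E (z + h) - E z - k * h) + k * h by rewrite subrK.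
apply: le_lt_trans (absc_triangle _ _) _; rewrite abscM.
by apply: le_lt_trans h2; rewrite /m mulrDr mulr1 [absc h * _]mulrC lerD2r.
Qed.

Definition entire E := forall z, exists k, has_cderiv E z k.

Lemma cont_Re_hline E c : entire E ->
  continuous (fun x : R => complex.Re (E (x +i* c))).
Proof.
move=> dE x; have [k dk] := dE (x +i* c).
apply/cvgrPdist_lt => e e0; have [r r0 hr] := has_cderiv_cont dk e0.
near=> y; have := hr ((y - x)%:C).
rewrite absc_real => /(_ _)/(le_lt_trans (abs_Re_le _)).
rewrite (_ : (x +i* c) + (y - x)%:C = y +i* c); last by apply: complexP => /=; ring.
rewrite ReB => h; rewrite distrC; apply: h; rewrite distrC.
by near: y; apply/nbhs_ballP; exists r.
Unshelve. all: by end_near. Qed.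

Lemma cont_Im_vline E a : entire E ->
  continuous (fun y : R => complex.Im (E (a +i* y))).
Proof.
move=> dE x; have [k dk] := dE (a +i* x).
apply/cvgrPdist_lt => e e0; have [r r0 hr] := has_cderiv_cont dk e0.
near=> y; have := hr ('i * (y - x)%:C).
rewrite abscM absc_i mul1r absc_real => /(_ _)/(le_lt_trans (abs_Im_le _)).
rewrite (_ : (a +i* x) + 'i * (y - x)%:C = a +i* y); last by apply: complexP => /=; ring.
rewrite ImB => h; rewrite distrC; apply: h; rewrite distrC.
by near: y; apply/nbhs_ballP; exists r.
Unshelve. all: by end_near. Qed.

(* The real part of the integral of E along the boundary of [a, b] x [c, d]. *)
Definition bdint E a b c d : R :=
  integ (fun x => complex.Re (E (x +i* c))) a b
  - integ (fun x => complex.Re (E (x +i* d))) a b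
  + integ (fun y => complex.Im (E (a +i* y))) c d
  - integ (fun y => complex.Im (E (b +i* y))) c d.

Lemma bdint_quarters E a b c d x y : entire E ->
  a <= x -> x <= b -> c <= y -> y <= d ->
  bdint E a b c d = bdint E a x c y + bdint E x b c y +
    (bdint E a x y d + bdint E x b y d).
Proof.
move=> dE ax xb cy yd; rewrite /bdint.
do !rewrite (@integ_cat _ _ a x b) ?(@integ_cat _ _ c y d) //;
  try exact: cont_Re_hline; try exact: cont_Im_vline.
ring.
Qed.

(** An affine function has a primitive, so its boundary integral vanishes: the main terms on the
    four sides cancel and only e times the perimeter remains. *)
Lemma bdint_affine_bound E a b c d z0 (k1 k2 : R) e : entire E -> a <= b -> c <= d ->
  (forall x y, a <= x <= b -> c <= y <= d ->
    absc (E (x +i* y) - (z0 + (k1 +i* k2) * (x +i* y))) <= e) ->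
  `|bdint E a b c d| <= 2 * e * ((b - a) + (d - c)).
Proof.
move=> dE ab cd hE; case: z0 hE => p q hE.
have cR y := @cont_Re_hline E y dE.
have cI x := @cont_Im_vline E x dE.
have aab : a <= a <= b by rewrite lexx.
have bab : a <= b <= b by rewrite lexx andbT.
have ccd : c <= c <= d by rewrite lexx.
have dcd : c <= d <= d by rewrite lexx andbT.
have hR x y : a <= x <= b -> c <= y <= d ->
    `|complex.Re (E (x +i* y)) - ((p - k2 * y) + k1 * x)| <= e.
  move=> xab /(hE _ _ xab)/(le_trans (abs_Re_le _)).
  by congr (`|_| <= e); rewrite ReB ReD ReM /=; ring.
have hI x y : a <= x <= b -> c <= y <= d ->
    `|complex.Im (E (x +i* y)) - ((q + k2 * x) + k1 * y)| <= e.
  move=> xab /(hE _ _ xab)/(le_trans (abs_Im_le _)).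
  by congr (`|_| <= e); rewrite ImB ImD ImM /=; ring.
have h1 := integ_affine_bound (cR c) ab (fun x xab => hR x c xab ccd).
have h2 := integ_affine_bound (cR d) ab (fun x xab => hR x d xab dcd).
have h3 := integ_affine_bound (cI a) cd (fun y => hI a y aab).
have h4 := integ_affine_bound (cI b) cd (fun y => hI b y bab).
rewrite /bdint.
move: h1 h2 h3 h4; move: (integ _ a b) (integ _ a b) (integ _ c d) (integ _ c d).
move=> I1 I2 I3 I4; rewrite !ler_norml => /andP[? ?] /andP[? ?] /andP[? ?] /andP[? ?].
by apply/andP; split; lra.
Qed.

End Goursat.

(** * Subdivision of rectangles *)

Section GoursatThm.
Context {R : realType}.
Implicit Types (E : R[i] -> R[i]).

Lemma nested_segments (a b : nat -> R) :
  (forall n, a n <= b n) -> (forall n, a n <= a n.+1) ->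
  (forall n, b n.+1 <= b n) -> exists x, forall n, a n <= x <= b n.
Proof.
move=> ab a_incr b_decr.
have aM m n : (m <= n)%N -> a m <= a n.
  by move=> /subnK <-; elim: (n - m)%N => // k IH; exact: le_trans IH (a_incr _).
have bM m n : (m <= n)%N -> b n <= b m.
  by move=> /subnK <-; elim: (n - m)%N => // k; exact/le_trans/b_decr.
have ab' m n : a m <= b n.
  rewrite (le_trans (aM m (maxn m n) _)) ?leq_maxl //.
  by rewrite (le_trans (ab _)) // bM // leq_maxr.
exists (sup (range a)) => n; apply/andP; split.
  apply: ub_le_sup; last by exists n.
  by exists (b 0%N) => _ [m _ <-].
by apply: ge_sup => [|_ [m _ <-]//]; exists (a 0%N), 0%N.
Qed.

Lemma exp2_gt (x : R) : exists n, x < 2 ^+ n.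
Proof.
exists (Num.bound x).
have [x0|x0] := leP 0 x; last by rewrite (lt_trans x0) // exprn_gt0.
rewrite (lt_trans (archi_boundP x0)) // -natrX ltr_nat.
exact: ltn_expl.
Qed.

(** Goursat's bisection. The bound is quadratic in the half-perimeter, so it splits into four equal
    parts under halving, and a rectangle violating it has a quarter violating it. At the common
    point of the nested rectangles complex differentiability contradicts the violation. *)
Lemma bdint_small E (a c w h e : R) : entire E -> 0 <= w -> 0 <= h -> 0 < e ->
  `|bdint E a (a + w) c (c + h)| <= e * (w + h) ^+ 2.
Proof.
move=> dE w_ge0 h_ge0 e0; pose wn n : R := w / 2 ^+ n; pose hn n : R := h / 2 ^+ n.
have w0 n : 0 <= wn n by rewrite divr_ge0 // exprn_ge0.
have h0 n : 0 <= hn n by rewrite divr_ge0 // exprn_ge0.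
have wS n : wn n = wn n.+1 + wn n.+1.
  by rewrite /wn exprS; field; rewrite expf_neq0.
have hS n : hn n = hn n.+1 + hn n.+1.
  by rewrite /hn exprS; field; rewrite expf_neq0.
rewrite leNgt; apply/negP => bad0.
pose J n (p : R * R) := bdint E p.1 (p.1 + wn n) p.2 (p.2 + hn n).
pose bad n p := e * (wn n + hn n) ^+ 2 < `|J n p|.
(* The lower left corner of the first bad quarter. The fourth quarter is the default; it is bad when
   the other three are not and the parent is. *)
pose next n (p : R * R) : R * R :=
  if bad n.+1 p then p else
  if bad n.+1 (p.1 + wn n.+1, p.2) then (p.1 + wn n.+1, p.2) else
  if bad n.+1 (p.1, p.2 + hn n.+1) then (p.1, p.2 + hn n.+1) else
  (p.1 + wn n.+1, p.2 + hn n.+1).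
have next_bad n p : bad n p -> bad n.+1 (next n p).
  rewrite /next; do 3 (case: ifPn => //; rewrite [X in ~~ X]/bad -leNgt => ?).
  have JE : J n p = J n.+1 p + J n.+1 (p.1 + wn n.+1, p.2) +
     (J n.+1 (p.1, p.2 + hn n.+1) + J n.+1 (p.1 + wn n.+1, p.2 + hn n.+1)).
    rewrite /J (@bdint_quarters _ E _ _ _ _ (p.1 + wn n.+1) (p.2 + hn n.+1)) //=;
      by rewrite ?(wS n) ?(hS n) ?addrA ?lerDl.
  rewrite /bad JE (wS n) (hS n).
  move=> lt4; have := lt_le_trans lt4 (ler_normD _ _).
  have := ler_normD (J n.+1 p) (J n.+1 (p.1 + wn n.+1, p.2)).
  have := ler_normD (J n.+1 (p.1, p.2 + hn n.+1))
            (J n.+1 (p.1 + wn n.+1, p.2 + hn n.+1)).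
  by lra.
pose fix pt n : R * R := if n is m.+1 then next m (pt m) else (a, c).
have pt_bad n : bad n (pt n).
  elim: n => [|n /next_bad //].
  by rewrite /bad /J /= /wn /hn expr0 !divr1.
have next1 n p : p.1 <= (next n p).1 /\ (next n p).1 + wn n.+1 <= p.1 + wn n.
  have := w0 n.+1; rewrite (wS n) /next; do ?(case: ifP => /= _); split; lra.
have next2 n p : p.2 <= (next n p).2 /\ (next n p).2 + hn n.+1 <= p.2 + hn n.
  have := h0 n.+1; rewrite (hS n) /next; do ?(case: ifP => /= _); split; lra.
have [|||x hx] := @nested_segments (fun n => (pt n).1) (fun n => (pt n).1 + wn n).
- by move=> n; rewrite lerDl.
- by move=> n; have [] := next1 n (pt n).
- by move=> n; have [] := next1 n (pt n).
have [|||y hy] := @nested_segments (fun n => (pt n).2) (fun n => (pt n).2 + hn n).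
- by move=> n; rewrite lerDl.
- by move=> n; have [] := next2 n (pt n).
- by move=> n; have [] := next2 n (pt n).
have [[k1 k2] dk] := dE (x +i* y).
(* Precision e / 2, because the perimeter is twice the sum of the sides. *)
have [r r0 hr] := dk _ (divr_gt0 e0 (ltr0Sn R 1)).
have [n hn_r] := exp2_gt ((w + h) / r).
have wh_r : wn n + hn n < r.
  rewrite /wn /hn -mulrDl ltr_pdivrMr ?exprn_gt0 //.
  by rewrite mulrC -ltr_pdivrMr.
have := pt_bad n; rewrite /bad ltNge => /negP; apply.
have -> : e * (wn n + hn n) ^+ 2 = 2 * (e / 2 * (wn n + hn n)) *
  (((pt n).1 + wn n - (pt n).1) + ((pt n).2 + hn n - (pt n).2)) by field.
apply: (@bdint_affine_bound _ _ _ _ _ _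
  (E (x +i* y) - (k1 +i* k2) * (x +i* y)) k1 k2) => //; rewrite ?lerDl //.
move=> x' y' hx' hy'.
have dxy : absc ((x' - x) +i* (y' - y)) <= wn n + hn n.
  apply: le_trans (absc_le_ReIm _) _ => /=.
  move: (hx n) (hy n) hx' hy'.
  move=> /andP[? ?] /andP[? ?] /andP[? ?] /andP[? ?].
  by apply: lerD; rewrite ler_norml; apply/andP; split; lra.
apply: le_trans (ler_wpM2l _ dxy); last by rewrite divr_ge0 // ltW.
have := hr _ (le_lt_trans dxy wh_r); congr (absc _ <= _).
have -> : (x +i* y) + ((x' - x) +i* (y' - y)) = x' +i* y'.
  by apply: complexP => /=; ring.
have -> : (x' - x) +i* (y' - y) = (x' +i* y') - (x +i* y) by [].
by ring.
Qed.

Theorem goursat E (a b c d : R) : entire E -> a <= b -> c <= d ->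
  bdint E a b c d = 0.
Proof.
move=> dE ab cd; apply/eqP; rewrite -normr_le0 leNgt; apply/negP => J0.
set s := (b - a) + (d - c).
(* This precision times s^2 is strictly below the modulus of the integral, assumed nonzero. *)
have := @bdint_small E a c (b - a) (d - c) (`|bdint E a b c d| / (1 + s ^+ 2) / 2) dE.
rewrite !subr_ge0 !subrKC => /(_ ab cd); rewrite -/s.
have s0 : 0 < 1 + s ^+ 2 by rewrite ltr_wpDr ?sqr_ge0.
rewrite !divr_gt0 // => /(_ isT).
rewrite leNgt => /negP; apply.
rewrite mulrAC ltr_pdivrMr // mulrAC ltr_pdivrMr //.
by have := sqr_ge0 s; nra.
Qed.

End GoursatThm.

(** * Cauchy's estimate *)

Section ComplexCalculus.
Context {R : realType}.
Implicit Types (E F : R[i] -> R[i]) (z k l : R[i]).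

Lemma is_derive_eps (f : R -> R) (x df e : R) : is_derive x 1 f df -> 0 < e ->
  exists2 r, 0 < r & forall h, `|h| < r -> `|f (x + h) - f x - df * h| <= e * `|h|.
Proof.
case=> fx <- e0; move/cvgrPdist_le : fx => /(_ _ e0).
rewrite near_withinE => /nbhs_ballP[r /= r0 hr]; exists r => // h hlt.
have [->|h0] := eqVneq h 0; first by rewrite addr0 mulr0 subr0 subrr normr0 mulr0.
have := hr h; rewrite /ball /= sub0r normrN => /(_ hlt h0).
rewrite -[lim _]/('D_1 f x) /GRing.scale /= mulr1 [h + x]addrC.
move: ('D_1 f x : R) => d hd.
have -> : f (x + h) - f x - d * h = - ((d - h^-1 * (f (x + h) - f x)) * h) :> R.
  by field.
by rewrite normrN normrM ler_wpM2r.
Qed.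

Lemma eps_is_derive (f : R -> R) (x df : R) :
  (forall e, 0 < e -> exists2 r, 0 < r &
    forall h, `|h| < r -> `|f (x + h) - f x - df * h| <= e * `|h|) ->
  is_derive x 1 f df.
Proof.
move=> H; suff cv : ((fun h : R => h^-1 *: ((f \o shift x) (h *: 1) - f x)) @ 0^' --> df)%classic.
  by apply: DeriveDef; [exact: cvgP cv|exact: cvg_lim cv].
apply/cvgrPdist_le => e /H[r r0 hr]; rewrite near_withinE.
apply/nbhs_ballP; exists r => // h; rewrite /ball /= sub0r normrN => /hr {}hr h0.
rewrite /GRing.scale /= mulr1 [h + x]addrC.
have -> : df - h^-1 * (f (x + h) - f x) = - ((f (x + h) - f x - df * h) / h).
  by field.
by rewrite normrN normrM normfV ler_pdivrMr ?normr_gt0.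
Qed.

(** Products and compositions produce a constant times [e], and [e <= 1] absorbs the terms of higher
    degree in [e]. *)
Lemma has_cderiv_weak E z k (C : R) : 0 <= C ->
  (forall e, 0 < e -> e <= 1 -> exists2 r, 0 < r & forall h, absc h < r ->
    absc (E (z + h) - E z - k * h) <= C * e * absc h) -> has_cderiv E z k.
Proof.
move=> C0 H e e0; pose e' := Num.min 1 (e / (C + 1)).
have C1 : 0 < C + 1 by rewrite ltr_wpDl.
have [||r r0 hr] := H e'; first by rewrite lt_min ltr01 divr_gt0.
  by rewrite ge_min lexx.
exists r => // h /hr /le_trans; apply; rewrite ler_wpM2r ?absc_ge0 //.
have : e' <= e / (C + 1) by rewrite ge_min lexx orbT.
rewrite ler_pdivlMr // => /(le_trans _); apply.
rewrite mulrC ler_wpM2l ?lerDl //.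
by rewrite le_min ler01 divr_ge0 ?ltW.
Qed.

Lemma has_cderiv_lip E z k : has_cderiv E z k ->
  exists2 r, 0 < r & forall h, absc h < r ->
    absc (E (z + h) - E z) <= (absc k + 1) * absc h.
Proof.
move=> /(_ _ ltr01)[r r0 hr]; exists r => // h /hr.
rewrite mul1r => hh; rewrite -[E _ - _](subrK (k * h)).
by rewrite (le_trans (absc_triangle _ _)) // abscM mulrDl mul1r addrC lerD2l.
Qed.

Lemma has_cderivD E F z k l : has_cderiv E z k -> has_cderiv F z l ->
  has_cderiv (fun w => E w + F w) z (k + l).
Proof.
move=> dE dF; apply: (@has_cderiv_weak _ _ _ 2) => // e e0 _.
have [r r0 hr] := dE _ e0; have [s s0 hs] := dF _ e0.
exists (Num.min r s) => [|h]; first by rewrite lt_min r0.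
rewrite lt_min => /andP[/hr h1 /hs h2].
have -> : E (z + h) + F (z + h) - (E z + F z) - (k + l) * h =
  (E (z + h) - E z - k * h) + (F (z + h) - F z - l * h) by ring.
by apply: le_trans (absc_triangle _ _) _; lra.
Qed.

Lemma has_cderiv_cst z (c : R[i]) : has_cderiv (fun=> c) z 0.
Proof.
move=> e e0; exists 1 => // h _.
by rewrite subrr mul0r subr0 absc0 mulr_ge0 ?absc_ge0 ?ltW.
Qed.

Lemma has_cderiv_id z : has_cderiv id z 1.
Proof.
move=> e e0; exists 1 => // h _.
rewrite (_ : _ - _ = 0); last by ring.
by rewrite absc0 mulr_ge0 ?absc_ge0 ?ltW.
Qed.

Lemma has_cderivM E F z k l : has_cderiv E z k -> has_cderiv F z l ->
  has_cderiv (fun w => E w * F w) z (k * F z + E z * l).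
Proof.
move=> dE dF; pose C := (absc (F z) + 1) + absc k * 1 + absc (E z).
have C0 : 0 <= C by rewrite !addr_ge0 ?mulr_ge0 ?absc_ge0.
apply: (@has_cderiv_weak _ _ _ C) => // e e0 e1.
have [r r0 hr] := dE _ e0; have [s s0 hs] := dF _ e0.
have [t t0 ht] := has_cderiv_cont dF e0.
exists (Num.min r (Num.min s t)) => [|h]; first by rewrite !lt_min r0 s0.
rewrite !lt_min => /andP[/hr h1 /andP[/hs h2 /ht h3]].
have -> : E (z + h) * F (z + h) - E z * F z - (k * F z + E z * l) * h =
  (E (z + h) - E z - k * h) * (F z + (F (z + h) - F z)) +
  k * h * (F (z + h) - F z) + E z * (F (z + h) - F z - l * h) by ring.
set X := (X in X * (_ + _)) in h1 *; set Y := F (z + h) - F z in h3 *.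
set Z := F (z + h) - F z - l * h in h2 *.
have b1 : absc (X * (F z + Y)) <= e * absc h * (absc (F z) + 1).
  rewrite abscM ler_pM ?absc_ge0 // (le_trans (absc_triangle _ _)) // lerD2l.
  exact: le_trans (ltW h3) e1.
have b2 : absc (k * h * Y) <= absc k * absc h * e.
  by rewrite !abscM ler_wpM2l ?mulr_ge0 ?absc_ge0 // ltW.
have b3 : absc (E z * Z) <= absc (E z) * (e * absc h).
  by rewrite abscM ler_wpM2l ?absc_ge0.
have := absc_triangle (X * (F z + Y) + k * h * Y) (E z * Z).
have := absc_triangle (X * (F z + Y)) (k * h * Y).
by rewrite /C; lra.
Qed.

Lemma has_cderiv_comp E F z k l : has_cderiv E z k -> has_cderiv F (E z) l ->
  has_cderiv (fun w => F (E w)) z (l * k).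
Proof.
move=> dE dF; pose C := (absc k + 1) + absc l.
have C0 : 0 <= C by rewrite !addr_ge0 ?absc_ge0.
apply: (@has_cderiv_weak _ _ _ C) => // e e0 e1.
have [r r0 hr] := dE _ e0; have [s s0 hs] := has_cderiv_lip dE.
have [t t0 ht] := dF _ e0; have [u u0 hu] := has_cderiv_cont dE t0.
exists (Num.min r (Num.min s u)) => [|h]; first by rewrite !lt_min r0 s0.
rewrite !lt_min => /andP[/hr h1 /andP[/hs h2 /hu h3]].
have := ht _ h3; rewrite subrKC => h4.
have -> : F (E (z + h)) - F (E z) - l * k * h =
  (F (E (z + h)) - F (E z) - l * (E (z + h) - E z)) +
  l * (E (z + h) - E z - k * h) by ring.
apply: le_trans (absc_triangle _ _) _; rewrite abscM.
have b1 := ler_wpM2l (absc_ge0 l) h1; have b2 := ler_wpM2l (ltW e0) h2.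
by rewrite /C; lra.
Qed.

Lemma has_cderiv_unique E z k l : has_cderiv E z k -> has_cderiv E z l -> k = l.
Proof.
move=> dk dl; apply/eqP; rewrite -subr_eq0 -absc_eq0 -normr_le0 leNgt.
apply/negP; rewrite normr_gt0 absc_eq0 -absc_gt0 => kl0.
pose e := absc (k - l) / 4; have e0 : 0 < e by rewrite divr_gt0.
have [r r0 hr] := dk _ e0; have [s s0 hs] := dl _ e0.
pose t := Num.min r s / 2; have m0 : 0 < Num.min r s by rewrite lt_min r0.
have t0 : 0 < t by rewrite divr_gt0.
have th : t < Num.min r s by rewrite /t; lra.
move: (th); rewrite lt_min => /andP[tr ts].
have ta : absc t%:C = t by rewrite absc_real gtr0_norm.
have := hr t%:C; have := hs t%:C; rewrite ta => /(_ ts) h1 /(_ tr) h2.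
have : absc ((k - l) * t%:C) <= e * t + e * t.
  apply: le_trans (lerD h1 h2); apply: le_trans (absc_triangleB _ _).
  by rewrite le_eqVlt; apply/orP; left; apply/eqP; congr absc; ring.
rewrite abscM ta -mulrDl ler_pM2r // /e; lra.
Qed.

End ComplexCalculus.

(** * The complex exponential and the estimate on circles *)

Section CauchyEstimate.
Context {R : realType}.
Implicit Types (E F : R[i] -> R[i]) (z w k l : R[i]).

Definition cexp z : R[i] :=
  (expR (complex.Re z) * cos (complex.Im z)) +i*
  (expR (complex.Re z) * sin (complex.Im z)).

Lemma cexpD z w : cexp (z + w) = cexp z * cexp w.
Proof.
apply: complexP; rewrite ?ReM ?ImM /= ReD ImD expRD ?cosD ?sinD; ring.
Qed.

Lemma cexp0 : cexp 0 = 1.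
Proof. by apply: complexP; rewrite /= expR0 ?cos0 ?sin0; ring. Qed.

Lemma absc_cexp z : absc (cexp z) = expR (complex.Re z).
Proof.
by rewrite /absc /= !exprMn -mulrDr cos2Dsin2 mulr1 sqrtr_sqr ger0_norm // expR_ge0.
Qed.

Lemma cexpN z : cexp (- z) = (cexp z)^-1.
Proof.
have z0 : cexp z != 0 by rewrite -absc_gt0 absc_cexp expR_gt0.
by apply: (mulfI z0); rewrite divff // -cexpD subrr cexp0.
Qed.

(** The three real expansions at 0 are combined. The real part of the error is at most e |x| + 2 e
    |y|, the imaginary part at most 2 e |y| + e |y|; together 6 e |h|. *)
Lemma has_cderiv_cexp0 : has_cderiv cexp 0 1.
Proof.
apply: (@has_cderiv_weak _ _ _ _ 6) => // e e0 e1.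
have [r r0 hr] := is_derive_eps (is_derive_expR (0 : R)) e0.
have [s s0 hs] := is_derive_eps (is_derive_sin (0 : R)) e0.
have [t t0 ht] := is_derive_eps (is_derive_cos (0 : R)) e0.
(* The e / 2 gives |exp x - 1| <= 2 |x| <= e. *)
exists (Num.min (Num.min r (e / 2)) (Num.min s t)) => [|h].
  by rewrite !lt_min r0 divr_gt0 ?s0.
rewrite !lt_min => /andP[/andP[hr' he] /andP[hs' ht']].
have x1 := abs_Re_le h; have y1 := abs_Im_le h.
have := hr (complex.Re h) (le_lt_trans x1 hr').
have := hs (complex.Im h) (le_lt_trans y1 hs').
have := ht (complex.Im h) (le_lt_trans y1 ht').
rewrite !add0r expR0 sin0 cos0 oppr0 !mul0r !subr0 ?addr0 !mul1r cexp0.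
move: (cos_max (complex.Im h)); rewrite /cexp.
set x := complex.Re h in x1 *; set y := complex.Im h in y1 *.
set ex := expR x; set c := cos y; set sn := sin y => c_le1 bc bs bx.
have bn1 : `|sn| <= 2 * `|y|.
  have := ler_normD (sn - y) y; rewrite subrK => /le_trans; apply.
  by have := ler_wpM2r (normr_ge0 y) e1; lra.
have bx1 : `|ex - 1| <= e.
  have := ler_normD (ex - 1 - x) x; rewrite subrK => /le_trans; apply.
  by have := ler_wpM2r (normr_ge0 x) e1; lra.
apply: le_trans (absc_le_ReIm _) _; rewrite !ReB !ImB /= -/x -/y subr0.
have -> : ex * c - 1 - x = (ex - 1 - x) * c + (1 + x) * (c - 1) by ring.
have -> : ex * sn - y = (ex - 1) * sn + (sn - y) by ring.
have b1 : `|(ex - 1 - x) * c| <= e * `|x|.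
  by rewrite normrM -[leRHS]mulr1 ler_pM.
have b2 : `|(1 + x) * (c - 1)| <= 2 * (e * `|y|).
  rewrite normrM ler_pM // (le_trans (ler_normD _ _)) // normr1; lra.
have b3 : `|(ex - 1) * sn| <= e * (2 * `|y|) by rewrite normrM ler_pM.
have := ler_normD ((ex - 1 - x) * c) ((1 + x) * (c - 1)).
have := ler_normD ((ex - 1) * sn) (sn - y).
have := ler_wpM2l (ltW e0) x1; have := ler_wpM2l (ltW e0) y1; lra.
Qed.

Lemma has_cderiv_cexp z : has_cderiv cexp z (cexp z).
Proof.
have cz : has_cderiv (fun w => w + - z) z (1 + 0).
  exact: has_cderivD (has_cderiv_id _) (has_cderiv_cst _ _).
have := @has_cderiv_comp R _ cexp z _ 1 cz.
rewrite /= subrr => /(_ has_cderiv_cexp0).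
move=> /(has_cderivM (has_cderiv_cst z (cexp z))).
rewrite mul0r !addr0 !mul1r add0r mulr1; congr (has_cderiv _ _ _).
by apply: funext => w; rewrite -cexpD subrKC.
Qed.

(* The function w |-> (F (a + exp w) - F a) * exp (- w) is entire and 2 i pi
   periodic, so by Goursat's theorem its integral over a vertical period does
   not depend on Re w; it tends to 2 pi k as Re w tends to - oo. *)
Lemma abs_Im_cderiv_le F a k (r M : R) : entire F -> has_cderiv F a k ->
  0 < r -> (forall z, absc (z - a) = r -> absc (F z - F a) <= M) ->
  `|complex.Im k| <= M / r.
Proof.
move=> dF dk r0 hM.
pose E w := (F (a + cexp w) + - F a) * cexp (- w).
have dE : entire E.
  move=> w; have [l dl] := dF (a + cexp w); eexists; apply: has_cderivM.
    apply: has_cderivD (has_cderiv_cst _ _).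
    apply: (@has_cderiv_comp R (fun w => a + cexp w) F w _ l _ dl).
    exact: has_cderivD (has_cderiv_cst _ _) (has_cderiv_cexp _).
  apply: (@has_cderiv_comp R -%R cexp w _ _ _ (has_cderiv_cexp _)).
  rewrite (_ : -%R = fun w => (-1) * w); last by apply: funext => ?; rewrite mulN1r.
  exact: has_cderivM (has_cderiv_cst _ _) (has_cderiv_id _).
have [q p1 per] : exists2 q : R, 0 < q & forall u, cexp (u +i* q) = cexp (u +i* 0).
  exists (pi *+ 2) => [|u]; first by rewrite pmulrn_lgt0 ?pi_gt0.
  by rewrite /cexp /= cos2pi sin2pi cos0 sin0.
have p0 := ltW p1.
apply/ler_addgt0Pr => e e0.
have [d d0 hd] := dk _ e0.
(* The right side of the rectangle is mapped by a + exp to the circle of radius r, where [hM]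
   applies. *)
have [X XE] : exists X, expR X = r by exists (ln r); rewrite lnK.
(* The left side is mapped to a circle of radius below d, on which the difference quotient E is
   within e of k. *)
have [x xX xd] : exists2 x, x <= X & expR x < d.
  exists (Num.min X (ln (d / 2))); first by rewrite ge_min lexx.
  rewrite (@le_lt_trans _ _ (d / 2)) //; last by lra.
  rewrite -[leRHS]lnK ?ler_expR ?ge_min ?lexx ?orbT //.
  by rewrite posrE divr_gt0.
have := goursat dE xX p0; rewrite /bdint.
(* By periodicity the horizontal sides cancel, so the two vertical integrals agree. *)
rewrite (_ : (fun x0 => complex.Re (E (x0 +i* q))) =
             (fun x0 => complex.Re (E (x0 +i* 0)))); last first.
  apply: funext => u; congr (complex.Re _).
  by rewrite /E !cexpN per.
rewrite subrr add0r => /eqP; rewrite subr_eq0 => /eqP JE.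
have := @integ_affine_bound R _ 0 q e (complex.Im k) 0
  (@cont_Im_vline R E x dE) p0; rewrite JE.
have /= := @integ_bound R _ 0 q (M / r) (@cont_Im_vline R E X dE) p0.
move: (integ _ _ _) => I.
have hX y : 0 <= y <= q -> `|complex.Im (E (X +i* y))| <= M / r.
  move=> _; apply: le_trans (abs_Im_le _) _.
  have rE : absc (cexp (X +i* y)) = r by rewrite absc_cexp.
  rewrite /E abscM cexpN abscV rE ler_pM2r; last by rewrite invr_gt0.
  by apply: hM; rewrite addrAC subrr add0r.
have hx y : 0 <= y <= q -> `|complex.Im (E (x +i* y)) - (complex.Im k + 0 * y)| <= e.
  move=> _; rewrite mul0r addr0 -ImB; apply: le_trans (abs_Im_le _) _.
  set w := x +i* y; have cw : cexp w != 0 by rewrite -absc_gt0 absc_cexp expR_gt0.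
  have -> : E w - k = (F (a + cexp w) - F a - k * cexp w) / cexp w.
    by rewrite /E cexpN; field.
  rewrite [absc (_ / _)]abscM abscV ler_pdivrMr; last by rewrite absc_gt0.
  by apply: hd; rewrite absc_cexp; exact: xd.
move=> /(_ hX) h1 /(_ hx); rewrite mul0r mul0r addr0 !subr0 => h2.
rewrite -(ler_pM2r p1) -[X in _ * X <= _](gtr0_norm p1) -normrM mulrDl.
rewrite subr0 in h1; rewrite -[X in `|X|](subKr I).
exact: le_trans (ler_normB _ _) (lerD h1 h2).
Qed.

(** Re k is the imaginary part of i k, the derivative of i F; adding the two bounds costs the factor
    2. *)
Lemma cauchy_estimate F a k (r M : R) : entire F -> has_cderiv F a k ->
  0 < r -> (forall z, absc (z - a) = r -> absc (F z - F a) <= M) ->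
  absc k <= 2 * M / r.
Proof.
move=> dF dk r0 hM; apply: le_trans (absc_le_ReIm _) _.
have dM z l : has_cderiv F z l -> has_cderiv (fun z => 'i * F z) z ('i * l).
  by move=> /(has_cderivM (has_cderiv_cst z 'i)); rewrite mul0r add0r.
have h1 := abs_Im_cderiv_le dF dk r0 hM.
have := @abs_Im_cderiv_le (fun z => 'i * F z) a ('i * k) r M _ (dM _ _ dk) r0.
rewrite ImM /= mul0r mul1r add0r => h2.
rewrite -mulrA mulr_natl mulr2n lerD // h2 //.
  by move=> z; have [l /dM] := dF z; exists ('i * l).
by move=> z /hM; rewrite -mulrBr abscM absc_i mul1r.
Qed.

End CauchyEstimate.

(** * Holomorphic functions of several variables *)

Section SeveralVariables.
Context {R : realType} {n : nat}.
Notation V := 'cV[R[i]]_n.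
Implicit Types (g : V -> R[i]) (z w h y : V) (G : 'rV[R[i]]_n).

(** The sum norm with real values: it is homogeneous under complex scalars, dominates each
    coordinate, and equals 1 on basis vectors. *)
Definition nv z : R := \sum_k absc (z k 0).

Lemma nv_ge0 z : 0 <= nv z.
Proof. by apply: sumr_ge0 => k _; exact: absc_ge0. Qed.

Lemma nvD z w : nv (z + w) <= nv z + nv w.
Proof.
by rewrite /nv -big_split /=; apply: ler_sum => k _; rewrite mxE absc_triangle.
Qed.

Lemma nvZ (t : R[i]) z : nv (t *: z) = absc t * nv z.
Proof. by rewrite /nv mulr_sumr; apply: eq_bigr => k _; rewrite mxE abscM. Qed.

Lemma nv0 : nv 0 = 0.
Proof. by rewrite /nv big1 // => k _; rewrite mxE absc0. Qed.

Lemma nv_coord z k : absc (z k 0) <= nv z.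
Proof.
rewrite /nv (bigD1 k) //= lerDl; apply: sumr_ge0 => *; exact: absc_ge0.
Qed.

Lemma nv_eq0 z : nv z = 0 -> z = 0.
Proof.
move=> z0; apply/matrixP => k j; rewrite ord1 mxE; apply/eqP.
by rewrite -absc_eq0 eq_le absc_ge0 andbT -z0 nv_coord.
Qed.

Definition pair_row G w : R[i] := (G *m w) 0 0.

Lemma pair_rowE G w : pair_row G w = \sum_k G 0 k * w k 0.
Proof. by rewrite /pair_row mxE. Qed.

Lemma pair_rowDl G G' w : pair_row (G + G') w = pair_row G w + pair_row G' w.
Proof. by rewrite /pair_row mulmxDl mxE. Qed.

Lemma pair_rowNl G w : pair_row (- G) w = - pair_row G w.
Proof. by rewrite /pair_row mulNmx mxE. Qed.

Lemma pair_rowZl c G w : pair_row (c *: G) w = c * pair_row G w.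
Proof. by rewrite /pair_row -scalemxAl mxE. Qed.

Lemma pair_rowDr G w w' : pair_row G (w + w') = pair_row G w + pair_row G w'.
Proof. by rewrite /pair_row mulmxDr mxE. Qed.

Lemma pair_rowZr c G w : pair_row G (c *: w) = c * pair_row G w.
Proof. by rewrite /pair_row -scalemxAr mxE. Qed.

Lemma pair_row_delta G k : pair_row G (delta_mx k 0) = G 0 k.
Proof. by rewrite /pair_row -colE mxE. Qed.

Lemma pair_row_bound G w : absc (pair_row G w) <= (\sum_k absc (G 0 k)) * nv w.
Proof.
rewrite pair_rowE mulr_suml (le_trans (absc_sum _)) //; apply: ler_sum => k _.
by rewrite abscM ler_wpM2l ?absc_ge0 ?nv_coord.
Qed.

Definition has_grad g z G := forall e : R, 0 < e ->
  exists2 r, 0 < r & forall h, nv h < r ->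
    absc (g (z + h) - g z - pair_row G h) <= e * nv h.

Definition hol g := forall z, exists G, has_grad g z G.

(** The default 0 is taken only where no complex differential exists, hence never for [hol]
    functions. *)
Definition grad g z : 'rV[R[i]]_n := xget 0 [set G | has_grad g z G]%classic.

Lemma gradP g z : hol g -> has_grad g z (grad g z).
Proof. by move=> /(_ z)[G dG]; exact: (xgetPex 0 (ex_intro _ G dG)). Qed.

Lemma has_grad_line g z G w : has_grad g z G ->
  has_cderiv (fun t => g (z + t *: w)) 0 (pair_row G w).
Proof.
move=> dG e e0; have w1 : 0 < nv w + 1 by rewrite ltr_wpDl ?nv_ge0.
have [r r0 hr] := dG _ (divr_gt0 e0 w1).
exists (r / (nv w + 1)) => [|t]; first by rewrite divr_gt0.
rewrite ltr_pdivlMr // add0r scale0r addr0 => tr.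
have := hr (t *: w); rewrite nvZ pair_rowZr [t * _]mulrC => /(_ _)/le_trans; apply.
  by apply: le_lt_trans tr; rewrite ler_wpM2l ?absc_ge0 //; lra.
rewrite -mulrA ler_pM2l // mulrC ler_pdivrMr // ler_wpM2l ?absc_ge0 //; lra.
Qed.

Lemma has_cderiv_line g z w (t : R[i]) : hol g ->
  has_cderiv (fun s => g (z + s *: w)) t (pair_row (grad g (z + t *: w)) w).
Proof.
move=> hg; have := has_grad_line w (gradP (z + t *: w) hg).
move=> d e /d[r r0 hr]; exists r => // h /hr.
by rewrite add0r scale0r addr0 -[z + t *: w + _]addrA -scalerDl.
Qed.

Lemma has_grad_unique g z G G' : has_grad g z G -> has_grad g z G' -> G = G'.
Proof.
move=> d d'; apply/rowP => k; rewrite -!pair_row_delta.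
exact: has_cderiv_unique (has_grad_line _ d) (has_grad_line _ d').
Qed.

Lemma grad_eq g z G : hol g -> has_grad g z G -> grad g z = G.
Proof. by move=> /(gradP z); exact: has_grad_unique. Qed.

Lemma has_gradB g g' z G G' : has_grad g z G -> has_grad g' z G' ->
  has_grad (fun y => g y - g' y) z (G - G').
Proof.
move=> d d' e e0; have e2 : 0 < e / 2 by rewrite divr_gt0.
have [r r0 hr] := d _ e2; have [s s0 hs] := d' _ e2.
exists (Num.min r s) => [|h]; first by rewrite lt_min r0.
rewrite lt_min => /andP[/hr h1 /hs h2].
rewrite pair_rowDl pair_rowNl.
have -> : g (z + h) - g' (z + h) - (g z - g' z) - (pair_row G h - pair_row G' h) =
  (g (z + h) - g z - pair_row G h) - (g' (z + h) - g' z - pair_row G' h) by ring.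
by apply: le_trans (absc_triangleB _ _) _; lra.
Qed.

Lemma has_gradZ (c : R[i]) g z G : has_grad g z G ->
  has_grad (fun y => c * g y) z (c *: G).
Proof.
move=> d e e0; have c1 : 0 < absc c + 1 by rewrite ltr_wpDl ?absc_ge0.
have [r r0 hr] := d _ (divr_gt0 e0 c1).
exists r => // h /hr; rewrite pair_rowZl -!mulrBr abscM => hh.
rewrite (le_trans (ler_wpM2l (absc_ge0 c) hh)) // mulrA ler_wpM2r ?nv_ge0 //.
rewrite mulrA ler_pdivrMr // mulrC ler_pM2l //; lra.
Qed.

Lemma has_grad_shift g z h G : has_grad g (z + h) G ->
  has_grad (fun y => g (y + h)) z G.
Proof. by move=> d e /d[r r0 hr]; exists r => // k /hr; rewrite [z + h + k]addrAC. Qed.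

Lemma hol_diff g h : hol g -> hol (fun y => g (y + h) - g y).
Proof.
move=> hg z; exists (grad g (z + h) - grad g z); apply: has_gradB.
  exact/has_grad_shift/gradP.
exact: gradP.
Qed.

Lemma grad_diff g h z : hol g ->
  grad (fun y => g (y + h) - g y) z = grad g (z + h) - grad g z.
Proof.
move=> hg; apply: grad_eq; first exact: hol_diff.
apply: has_gradB; first exact/has_grad_shift/gradP.
exact: gradP.
Qed.

Lemma holZ c g : hol g -> hol (fun y => c * g y).
Proof. by move=> hg z; exists (c *: grad g z); exact/has_gradZ/gradP. Qed.

(** Differentiability at z alone bounds g near z; this is the M that enters all Cauchy estimates
    below. *)
Lemma hol_locally_bounded g z : hol g ->
  exists2 r, 0 < r & exists2 M, 0 <= M &
    forall y, nv (y - z) <= r -> absc (g y) <= M.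
Proof.
move=> hg; have [r r0 hr] := gradP z hg ltr01.
pose S := \sum_k absc (grad g z 0 k).
have S0 : 0 <= S by apply: sumr_ge0 => *; exact: absc_ge0.
exists (r / 2); first by rewrite divr_gt0.
exists (absc (g z) + (S + 1) * (r / 2)) => [|y hy].
  by rewrite addr_ge0 ?absc_ge0 // mulr_ge0 ?divr_ge0 ?addr_ge0 // ltW.
have := hr (y - z); rewrite subrKC mul1r => /(_ _) h1.
rewrite -[g y](subrK (g z)) addrC (le_trans (absc_triangle _ _)) // lerD2l.
rewrite -[_ - _](subrK (pair_row (grad g z) (y - z))).
rewrite (le_trans (absc_triangle _ _)) // mulrDl mul1r addrC lerD //.
  by rewrite (le_trans (pair_row_bound _ _)) // ler_wpM2l.
by apply: (le_trans _ hy); apply: h1; lra.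
Qed.

(** Cauchy's estimate for t |-> g (z + t w) on the circle of radius r / nv w. Increments of g are at
    most 2 M, whence 4 M. *)
Lemma grad_bound g z (r M : R) w : hol g -> 0 < r ->
  (forall y, nv (y - z) <= r -> absc (g y) <= M) ->
  absc (pair_row (grad g z) w) <= 4 * M / r * nv w.
Proof.
move=> hg r0 hM; have [w0|] := eqVneq (nv w) 0.
  by rewrite w0 mulr0 (nv_eq0 w0) /pair_row mulmx0 mxE absc0.
rewrite -normr_gt0 ger0_norm ?nv_ge0 // => w0.
have M0 : 0 <= M by rewrite (le_trans (absc_ge0 (g z))) // hM // subrr nv0 ltW.
have dF : entire (fun t => g (z + t *: w)).
  by move=> t; eexists; exact: has_cderiv_line.
have := @has_cderiv_line g z w 0 hg; rewrite scale0r addr0 => d0.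
have := @cauchy_estimate R _ _ _ (r / nv w) (2 * M) dF d0 (divr_gt0 r0 w0).
have -> : 2 * (2 * M) / (r / nv w) = 4 * M / r * nv w.
  by field; rewrite !gt_eqF.
apply=> t; rewrite subr0 scale0r addr0 => tr.
rewrite (le_trans (absc_triangleB _ _)) // mulr_natl mulr2n lerD //.
  by apply: hM; rewrite addrAC subrr add0r nvZ tr divfK ?gt_eqF.
by apply: hM; rewrite subrr nv0 ltW.
Qed.

(** There is no mean value equality for complex values; real and imaginary parts are treated
    separately, whence the factor 2. *)
Lemma mean_value_complex (F dF : R[i] -> R[i]) (e : R) :
  (forall t : R, has_cderiv F t%:C (dF t%:C)) ->
  (forall t : R, 0 <= t <= 1 -> absc (dF t%:C) <= e) -> absc (F 1 - F 0) <= 2 * e.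
Proof.
move=> dFP hdF; apply: le_trans (absc_le_ReIm _) _; rewrite ReB ImB.
rewrite mulr_natl mulr2n; apply: lerD.
- have := @mean_value_bound R (fun t : R => complex.Re (F t%:C))
    (fun t : R => complex.Re (dF t%:C)) 0 1 e ler01.
  rewrite subr0 mulr1; apply=> [t _|t /hdF]; last exact/le_trans/abs_Re_le.
  apply: eps_is_derive => a /(dFP t)[r r0 hr]; exists r => // h hh.
  have := hr h%:C; rewrite absc_real => /(_ hh)/(le_trans (abs_Re_le _)).
  by rewrite -raddfD !ReB ReM /= mulr0 subr0.
- have := @mean_value_bound R (fun t : R => complex.Im (F t%:C))
    (fun t : R => complex.Im (dF t%:C)) 0 1 e ler01.
  rewrite subr0 mulr1; apply=> [t _|t /hdF]; last exact/le_trans/abs_Im_le.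
  apply: eps_is_derive => a /(dFP t)[r r0 hr]; exists r => // h hh.
  have := hr h%:C; rewrite absc_real => /(_ hh)/(le_trans (abs_Im_le _)).
  by rewrite -raddfD !ImB ImM /= mulr0 add0r.
Qed.

End SeveralVariables.

(** * Uniform Lipschitz and Taylor bounds *)

Section HolomorphicGradient.
Context {R : realType} {n : nat}.
Notation V := 'cV[R[i]]_n.
Implicit Types (g : V -> R[i]) (z w h y : V) (G : 'rV[R[i]]_n) (r M : R).

Lemma nv_segment h (t : R) : 0 <= t <= 1 -> nv (t%:C *: h) <= nv h.
Proof.
move=> /andP[t0 t1]; rewrite nvZ absc_real ger0_norm //.
by rewrite ler_piMl ?nv_ge0.
Qed.

Lemma nv_ball_segment z0 y y' r (t : R) : 0 <= t <= 1 ->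
  nv (y - z0) <= r -> nv (y' - z0) <= r ->
  nv (y + t%:C *: (y' - y) - z0) <= r.
Proof.
move=> /andP[t0 t1] hy hy'.
have -> : y + t%:C *: (y' - y) - z0 = (1 - t)%:C *: (y - z0) + t%:C *: (y' - z0).
  have -> : (1 - t)%:C = 1 - t%:C by rewrite rmorphB rmorph1.
  by apply/matrixP => i j; rewrite !mxE; ring.
apply: le_trans (nvD _ _) _; rewrite !nvZ !absc_real !ger0_norm ?subr_ge0 //.
have t1' : 0 <= 1 - t by rewrite subr_ge0.
have := ler_wpM2l t1' hy; have := ler_wpM2l t0 hy'; lra.
Qed.

Lemma holomorphic_lip g z0 r M y y' : hol g -> 0 < r ->
  (forall y, nv (y - z0) <= 2 * r -> absc (g y) <= M) ->
  nv (y - z0) <= r -> nv (y' - z0) <= r ->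
  absc (g y' - g y) <= 8 * M / r * nv (y' - y).
Proof.
move=> hg r0 hM hy hy'.
have := @mean_value_complex R (fun t => g (y + t *: (y' - y)))
  (fun t => pair_row (grad g (y + t *: (y' - y))) (y' - y))
  (4 * M / r * nv (y' - y)).
rewrite scale1r subrKC scale0r addr0.
rewrite (_ : 8 * M / r * nv (y' - y) = 2 * (4 * M / r * nv (y' - y))); last by ring.
apply=> [t|t t01]; first exact: has_cderiv_line.
apply: grad_bound => // x hx; apply: hM.
rewrite -(subrK (y + t%:C *: (y' - y)) x) -addrA.
apply: le_trans (nvD _ _) _; have := nv_ball_segment t01 hy hy'; lra.
Qed.

(** The increment y |-> g (y + h) - g y is itself holomorphic and of size O(nv h) by
    [holomorphic_lip] at radius 3 r, so Cauchy's estimate at radius r bounds its gradient without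
    second derivatives. The product of the constants 8 / 3 and 4 is rounded up to 11; the radius 6 r
    is twice 3 r. *)
Lemma grad_lip g z0 r M z h w : hol g -> 0 < r ->
  (forall y, nv (y - z0) <= 6 * r -> absc (g y) <= M) ->
  nv (z - z0) <= r -> nv h <= r ->
  absc (pair_row (grad g (z + h)) w - pair_row (grad g z) w)
    <= 11 * M / r ^+ 2 * nv h * nv w.
Proof.
move=> hg r0 hM hz hh.
have M0 : 0 <= M.
  by rewrite (le_trans (absc_ge0 (g z0))) // hM // subrr nv0 mulr_ge0 // ltW.
rewrite -pair_rowNl -pair_rowDl -grad_diff //.
have := @grad_bound R n (fun y => g (y + h) - g y) z r
  (8 * M / (3 * r) * nv h) w (hol_diff h hg) r0.
move=> H; apply: le_trans (H _) _ => [y hy|].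
  have hyz : nv (y - z0) <= 2 * r.
    by rewrite -(subrK z y) -addrA; apply: le_trans (nvD _ _) _; lra.
  have := @holomorphic_lip g z0 (3 * r) M y (y + h) hg.
  rewrite [y + h - y]addrAC subrr add0r; apply; first lra.
  - by move=> x hx; apply: hM; lra.
  - by lra.
  - by rewrite -addrA addrCA; apply: le_trans (nvD _ _) _; lra.
rewrite ler_wpM2r ?nv_ge0 //.
have -> : 4 * (8 * M / (3 * r) * nv h) / r = 32 / 3 * (M / r ^+ 2 * nv h).
  by field; rewrite gt_eqF.
have -> : 11 * M / r ^+ 2 * nv h = 11 * (M / r ^+ 2 * nv h).
  by field; rewrite gt_eqF.
rewrite ler_wpM2r //; last by lra.
by rewrite mulr_ge0 ?nv_ge0 // divr_ge0 // sqr_ge0.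
Qed.

Lemma taylor1 g z0 r M z h : hol g -> 0 < r ->
  (forall y, nv (y - z0) <= 6 * r -> absc (g y) <= M) ->
  nv (z - z0) <= r -> nv h <= r ->
  absc (g (z + h) - g z - pair_row (grad g z) h) <= 22 * M / r ^+ 2 * nv h ^+ 2.
Proof.
move=> hg r0 hM hz hh.
have M0 : 0 <= M.
  by rewrite (le_trans (absc_ge0 (g z0))) // hM // subrr nv0 mulr_ge0 // ltW.
pose q := pair_row (grad g z) h.
(* Subtracting the linear function q t leaves a derivative equal to a difference of gradients, as
   bounded by [grad_lip]. *)
have := @mean_value_complex R (fun t => g (z + t *: h) + (- q) * t)
  (fun t => pair_row (grad g (z + t *: h)) h + (0 * t + (- q)))
  (11 * M / r ^+ 2 * nv h * nv h).
rewrite scale1r scale0r addr0 mulr0 addr0 mulr1 addrAC.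
rewrite (_ : 22 * M / r ^+ 2 * nv h ^+ 2 = 2 * (11 * M / r ^+ 2 * nv h * nv h)); last first.
  by field; rewrite gt_eqF.
apply=> [t|t t01].
  apply: has_cderivD; first exact: has_cderiv_line.
  rewrite -[X in _ + X]mulr1.
  exact: (@has_cderivM R (fun=> - q) id _ _ _ (has_cderiv_cst _ _) (has_cderiv_id _)).
rewrite mul0r add0r.
have th := nv_segment h t01.
apply: le_trans (grad_lip _ hg r0 hM hz (le_trans th hh)) _.
rewrite ler_wpM2r ?nv_ge0 // ler_wpM2l //.
by rewrite divr_ge0 ?sqr_ge0 // mulr_ge0.
Qed.

Definition cvg_to (u : nat -> R[i]) (l : R[i]) := forall e : R, 0 < e ->
  exists N, forall k, (N <= k)%N -> absc (u k - l) <= e.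

Lemma cvg_toB u v l l' : cvg_to u l -> cvg_to v l' ->
  cvg_to (fun k => u k - v k) (l - l').
Proof.
move=> hu hv e e0; have e2 : 0 < e / 2 by rewrite divr_gt0.
have [N hN] := hu _ e2; have [N' hN'] := hv _ e2.
exists (maxn N N') => k; rewrite geq_max => /andP[/hN h1 /hN' h2].
have -> : u k - v k - (l - l') = (u k - l) - (v k - l') by ring.
by apply: le_trans (absc_triangleB _ _) _; lra.
Qed.

Lemma cvg_to_le u l (C : R) : cvg_to u l ->
  (exists N, forall k, (N <= k)%N -> absc (u k) <= C) -> absc l <= C.
Proof.
move=> hu [N' hN']; apply/ler_addgt0Pr => e /hu[N hN].
have h1 := hN _ (leq_maxl N N'); have h2 := hN' _ (leq_maxr N N').
rewrite -[l](subKr (u (maxn N N'))).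
by apply: le_trans (absc_triangleB _ _) _; exact: lerD.
Qed.

Lemma cvg_toM u l c : cvg_to u l -> cvg_to (fun k => u k * c) (l * c).
Proof.
move=> hu e e0; have c1 : 0 < absc c + 1 by rewrite ltr_wpDl ?absc_ge0.
have [N hN] := hu _ (divr_gt0 e0 c1); exists N => k /hN hk.
rewrite -mulrBl abscM (le_trans (ler_wpM2r (absc_ge0 c) hk)) //.
by rewrite mulrAC ler_pdivrMr // ler_pM2l //; lra.
Qed.

Lemma cvg_to_sum (I : finType) (u : I -> nat -> R[i]) (l : I -> R[i]) :
  (forall i, cvg_to (u i) (l i)) ->
  cvg_to (fun k => \sum_i u i k) (\sum_i l i).
Proof.
move=> hu; rewrite /index_enum; elim: (Finite.enum I) => [|i s IH] e e0.
  by exists 0%N => k _; rewrite !big_nil subr0 absc0 ltW.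
have e2 : 0 < e / 2 by rewrite divr_gt0.
have [N hN] := hu i _ e2; have [N' hN'] := IH _ e2.
exists (maxn N N') => k; rewrite geq_max !big_cons => /andP[/hN h1 /hN' h2].
rewrite opprD addrACA (le_trans (absc_triangle _ _)) //; lra.
Qed.

Lemma cauchy_cvg_to (u : nat -> R[i]) :
  (forall e : R, 0 < e -> exists N, forall k l, (N <= k)%N -> (N <= l)%N ->
     absc (u k - u l) <= e) -> exists l, cvg_to u l.
Proof.
move=> hu.
have real_case (v : nat -> R) : (forall k l, `|v k - v l| <= absc (u k - u l)) ->
    exists l, forall e, 0 < e -> exists N, forall k, (N <= k)%N -> `|v k - l| <= e.
  move=> huv; have cv : cvgn v.
    apply/cauchy_cvgP/cauchy_exP => e e0.
    have [N hN] := hu _ (divr_gt0 e0 (ltr0Sn R 1)).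
    exists (v N); exists N => // k /= Nk; rewrite /ball /=.
    rewrite (le_lt_trans (huv _ _)) // (le_lt_trans (hN _ _ (leqnn N) Nk)) //.
    by rewrite ltr_pdivrMr // ltr_pMr // ltr1n.
  exists (limn v) => e e0; move/cvgrPdist_le : cv => /(_ _ e0)[N _ hN].
  by exists N => k /hN; rewrite distrC.
have [|a ha] := real_case (fun k => complex.Re (u k)).
  by move=> k l; rewrite -ReB abs_Re_le.
have [|b hb] := real_case (fun k => complex.Im (u k)).
  by move=> k l; rewrite -ImB abs_Im_le.
exists (a +i* b) => e e0; have e2 : 0 < e / 2 by rewrite divr_gt0.
have [N hN] := ha _ e2; have [N' hN'] := hb _ e2.
exists (maxn N N') => k; rewrite geq_max => /andP[/hN h1 /hN' h2].
apply: le_trans (absc_le_ReIm _) _; rewrite ReB ImB /=; lra.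
Qed.

End HolomorphicGradient.

(** * Holomorphy and symmetry of directional derivatives *)

Section HolomorphicDerivatives.
Context {R : realType} {n : nat}.
Notation V := 'cV[R[i]]_n.
Implicit Types (g : V -> R[i]) (z w h y : V) (G : 'rV[R[i]]_n) (r M : R).

Lemma nv_delta (k : 'I_n) : nv (delta_mx k 0 : V) = 1.
Proof.
rewrite /nv (bigD1 k) //= big1 => [|i ik].
  by rewrite mxE !eqxx mulr1n (absc_real 1) normr1 addr0.
by rewrite mxE (negPf ik) absc0.
Qed.

Lemma small_quotient (a e : R) : 0 <= a -> 0 < e ->
  a * (e / (a + 1)) <= e.
Proof.
move=> a0 e0; rewrite mulrA ler_pdivrMr ?ltr_wpDl // mulrC ler_pM2l //; lra.
Qed.

(* Locally bounded holomorphic functions have locally uniform second order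
   Taylor remainders, so pointwise convergence forces their gradients to
   converge. *)
Lemma pointwise_limit_has_grad (gs : nat -> V -> R[i]) g z0 r M :
  (forall k, hol (gs k)) -> 0 < r ->
  (forall k y, nv (y - z0) <= 6 * r -> absc (gs k y) <= M) ->
  (forall y, cvg_to (fun k => gs k y) (g y)) -> exists G, has_grad g z0 G.
Proof.
move=> hgs r0 hM hcv.
have M0 : 0 <= M.
  by rewrite (le_trans (absc_ge0 (gs 0%N z0))) // hM // subrr nv0 mulr_ge0 // ltW.
pose C := 22 * M / r ^+ 2.
have C0 : 0 <= C by rewrite divr_ge0 ?sqr_ge0 // mulr_ge0.
have T k h : nv h <= r ->
    absc (gs k (z0 + h) - gs k z0 - pair_row (grad (gs k) z0) h) <= C * nv h ^+ 2.
  by move=> hr; apply: (@taylor1 R n (gs k) z0 r M) => //; rewrite ?subrr ?nv0 ?ltW //; exact: hM.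
have D h : cvg_to (fun k => gs k (z0 + h) - gs k z0) (g (z0 + h) - g z0).
  exact: cvg_toB.
clearbody C; clear hM M0.
have /boolp.choice[l hl] i : exists l, cvg_to (fun k => grad (gs k) z0 0 i) l.
  apply: cauchy_cvg_to => e e0.
  have C1 : 0 < C + 1 by rewrite ltr_wpDl.
  (* At step t along the i-th axis the difference quotient is within C t <= e / 4 of the gradient
     coordinate. For this fixed t the quotients converge in k; two such errors and two convergence
     errors of e / 4 add up to e. *)
  pose t := Num.min r (e / 4 / (C + 1)).
  have t0 : 0 < t by rewrite lt_min r0 !divr_gt0.
  have tr : t <= r by rewrite ge_min lexx.
  have Ct : C * t <= e / 4.
    apply: le_trans (small_quotient C0 _); last by rewrite divr_gt0.
    by rewrite ler_wpM2l // ge_min lexx orbT.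
  clearbody t; pose h : V := t%:C *: delta_mx i 0.
  have nh : nv h = t by rewrite nvZ nv_delta mulr1 absc_real gtr0_norm.
  have hr : nv h <= r by rewrite nh.
  have [|N hN] := D h (e * t / 4); first by rewrite divr_gt0 ?mulr_gt0.
  exists N => k m /hN hk /hN hm.
  have pE j : pair_row (grad (gs j) z0) h = t%:C * grad (gs j) z0 0 i.
    by rewrite pair_rowZr pair_row_delta.
  have := T k h hr; have := T m h hr; rewrite !pE nh.
  move: hk hm; set dk := gs k _ - _; set dm := gs m _ - _; set d := g _ - _.
  move=> hk hm hTm hTk.
  have : absc (t%:C * (grad (gs k) z0 0 i - grad (gs m) z0 0 i)) <= t * e.
    have -> : t%:C * (grad (gs k) z0 0 i - grad (gs m) z0 0 i) =
      ((dk - d) - (dm - d)) - ((dk - t%:C * grad (gs k) z0 0 i) -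
       (dm - t%:C * grad (gs m) z0 0 i)) by ring.
    apply: le_trans (absc_triangleB _ _) _.
    apply: le_trans (lerD (absc_triangleB _ _) (absc_triangleB _ _)) _.
    have := ler_wpM2r (ltW t0) Ct; rewrite expr2 in hTk hTm.
    by move: hk hm hTk hTm; lra.
  by rewrite abscM absc_real gtr0_norm // ler_pM2l.
exists (\row_i l i).
have T' h : nv h <= r ->
    absc (g (z0 + h) - g z0 - pair_row (\row_i l i) h) <= C * nv h ^+ 2.
  move=> hr; apply: (@cvg_to_le R
    (fun k => gs k (z0 + h) - gs k z0 - pair_row (grad (gs k) z0) h)).
    apply: cvg_toB => //; rewrite pair_rowE.
    rewrite (_ : (fun k => _) = fun k => \sum_i grad (gs k) z0 0 i * h i 0); last first.
      by apply: funext => k; rewrite pair_rowE.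
    by apply: cvg_to_sum => i; rewrite mxE; exact: cvg_toM.
  by exists 0%N => k _; exact: T.
move=> e e0; have C1 : 0 < C + 1 by rewrite ltr_wpDl.
exists (Num.min r (e / (C + 1))) => [|h]; first by rewrite lt_min r0 divr_gt0.
rewrite lt_min => /andP[hr he]; apply: le_trans (T' _ (ltW hr)) _.
rewrite expr2 mulrA ler_wpM2r ?nv_ge0 //.
by apply: le_trans (small_quotient C0 e0); rewrite ler_wpM2l // ltW.
Qed.

Definition pderiv g w z : R[i] := pair_row (grad g z) w.

Lemma pderiv_step g w z (e : R) : hol g -> 0 < e -> exists2 r, 0 < r &
  forall s : R, 0 < s -> s < r ->
    absc (g (z + s%:C *: w) - g z - s%:C * pderiv g w z) <= e * s.
Proof.
move=> hg e0; have := @has_cderiv_line R n g z w 0 hg.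
rewrite scale0r addr0 => /(_ e e0)[r r0 hr]; exists r => // s s0 sr.
have := hr s%:C; rewrite absc_real gtr0_norm // add0r scale0r addr0 => /(_ sr).
by rewrite [s%:C * _]mulrC.
Qed.

(** The bound on difference quotients is uniform in s. With y in the ball of radius 6 r and a
    displacement of at most 6 r, both points lie within 12 r, and [holomorphic_lip] needs the bound
    on twice that radius. *)
Lemma diff_bound g z0 r M w (s : R) y : hol g -> 0 < r ->
  (forall y, nv (y - z0) <= 24 * r -> absc (g y) <= M) ->
  0 < s -> s * nv w <= 6 * r -> nv (y - z0) <= 6 * r ->
  absc (g (y + s%:C *: w) - g y) <= M / r * nv w * s.
Proof.
move=> hg r0 hM s0 sw hy.
have nsw : nv (s%:C *: w) = s * nv w by rewrite nvZ absc_real gtr0_norm.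
have M0 : 0 <= M.
  by rewrite (le_trans (absc_ge0 (g z0))) // hM // subrr nv0 mulr_ge0 // ltW.
have := @holomorphic_lip R n g z0 (12 * r) M y (y + s%:C *: w) hg.
rewrite [y + _ - y]addrAC subrr add0r nsw => H; apply: le_trans (H _ _ _ _) _.
- by lra.
- by move=> x hx; apply: hM; lra.
- by lra.
- rewrite -addrA addrCA; apply: le_trans (nvD _ _) _; rewrite nsw; lra.
have -> : 8 * M / (12 * r) * (s * nv w) = 2 / 3 * (M / r * nv w * s).
  by field; rewrite gt_eqF.
rewrite ler_piMl //; last by lra.
by rewrite mulr_ge0 ?(ltW s0) // mulr_ge0 ?nv_ge0 // divr_ge0 // ltW.
Qed.

(** Difference quotients with steps [s k] tending to 0 are holomorphic and uniformly bounded near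
    z0, so their pointwise limit is differentiable there. As the conclusion has the form of the
    hypothesis, it can be iterated. *)
Theorem hol_pderiv g w : hol g -> hol (pderiv g w).
Proof.
move=> hg z0; have [R0 R00 [M M0 hM]] := hol_locally_bounded z0 hg.
pose r := R0 / 24; have r0 : 0 < r by rewrite divr_gt0.
have hM' y : nv (y - z0) <= 24 * r -> absc (g y) <= M.
  by move=> hy; apply: hM; move: hy; rewrite /r; lra.
clearbody r.
have w1 : 0 < nv w + 1 by rewrite ltr_wpDl ?nv_ge0.
(* The largest step keeps every displacement [s k * nv w] below 6 r, as [diff_bound] requires. *)
pose c := 6 * r / (nv w + 1); have c0 : 0 < c by rewrite divr_gt0 ?mulr_gt0.
have cw : c * nv w <= 6 * r.
  by rewrite mulrC small_quotient ?nv_ge0 ?mulr_gt0.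
clearbody c; pose s k : R := c / k.+1%:R.
have s0 k : 0 < s k by rewrite divr_gt0.
have sw k : s k * nv w <= 6 * r.
  apply: le_trans cw; rewrite ler_wpM2r ?nv_ge0 //.
  by rewrite ler_pdivrMr // ler_peMr ?(ltW c0) // ler1n.
have s_lt e : 0 < e -> exists N, forall k, (N <= k)%N -> s k < e.
  move=> e0; exists (Num.bound (c / e)) => k Nk; rewrite ltr_pdivrMr //.
  rewrite mulrC -ltr_pdivrMr //.
  apply: lt_le_trans (archi_boundP _) _; first by rewrite divr_ge0 ?ltW.
  by rewrite ler_nat (leq_trans Nk).
clearbody s.
apply: (@pointwise_limit_has_grad
  (fun k y => (s k)%:C^-1 * (g (y + (s k)%:C *: w) - g y)) _ z0 r (M / r * nv w)) => //.
- by move=> k; apply: holZ; exact: hol_diff.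
- move=> k y hy; rewrite abscM abscV absc_real gtr0_norm // mulrC.
  by rewrite ler_pdivrMr //; exact: diff_bound hM' _ _ hy.
- move=> y e e0; have [d d0 hd] := pderiv_step w y hg e0.
  have [N hN] := s_lt _ d0; exists N => k /hN sd.
  have sC : (s k)%:C != 0 by rewrite -absc_gt0 absc_real gtr0_norm.
  have -> : (s k)%:C^-1 * (g (y + (s k)%:C *: w) - g y) - pderiv g w y =
    (s k)%:C^-1 * (g (y + (s k)%:C *: w) - g y - (s k)%:C * pderiv g w y) by field.
  rewrite abscM abscV absc_real gtr0_norm // mulrC ler_pdivrMr //.
  exact: hd.
Qed.

(** The second difference is the increment along s w' of y |-> g (y + s w) - g y. That function is
    O(s), so its Taylor remainder is K s^3; the linear term is s times an increment of
    [pderiv g w'], expanded by [pderiv_step]. *)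
Lemma second_difference g z w w' (e : R) : hol g -> 0 < e -> exists2 r, 0 < r &
  forall s : R, 0 < s -> s < r ->
    absc (g (z + s%:C *: w + s%:C *: w') - g (z + s%:C *: w) - g (z + s%:C *: w') + g z
          - s%:C ^+ 2 * pderiv (pderiv g w') w z) <= e * s ^+ 2.
Proof.
move=> hg e0; have [R0 R00 [M M0 hM]] := hol_locally_bounded z hg.
pose r := R0 / 24; have r0 : 0 < r by rewrite divr_gt0.
have hM' y : nv (y - z) <= 24 * r -> absc (g y) <= M.
  by move=> hy; apply: hM; move: hy; rewrite /r; lra.
clearbody r; clear hM R0 R00.
have e2 : 0 < e / 2 by rewrite divr_gt0.
have [d d0 hd] := pderiv_step w z (hol_pderiv w' hg) e2.
have w0 := nv_ge0 w; have w0' := nv_ge0 w'.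
pose K := 22 * (M / r * nv w) / r ^+ 2 * nv w' ^+ 2.
have K0 : 0 <= K.
  by rewrite mulr_ge0 ?sqr_ge0 // divr_ge0 ?sqr_ge0 // !mulr_ge0 // invr_ge0 ltW.
pose c := Num.min (6 * r / (nv w + 1)) (r / (nv w' + 1)).
exists (Num.min d (Num.min c (e / 2 / (K + 1)))) => [|s s0].
  by rewrite !lt_min d0 !divr_gt0 ?mulr_gt0 ?ltr_wpDl.
rewrite !lt_min => /andP[sd /andP[/andP[sw sw'] sK]].
have {}sw : s * nv w <= 6 * r.
  apply: le_trans (small_quotient w0 _); last by rewrite mulr_gt0.
  by rewrite mulrC ler_wpM2l // ltW.
have {}sw' : s * nv w' <= r.
  by apply: le_trans (small_quotient w0' r0); rewrite mulrC ler_wpM2l // ltW.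
have {}sK : K * s <= e / 2.
  by apply: le_trans (small_quotient K0 e2); rewrite ler_wpM2l // ltW.
have nsw' : nv (s%:C *: w') = s * nv w' by rewrite nvZ absc_real gtr0_norm.
have := @taylor1 R n (fun y => g (y + s%:C *: w) - g y) z r
  (M / r * nv w * s) z (s%:C *: w') (hol_diff _ hg) r0.
rewrite subrr nv0 nsw' => /(_ _ (ltW r0) sw') T.
have {T} := T (fun y => diff_bound hg r0 hM' s0 sw).
rewrite grad_diff // pair_rowZr pair_rowDl pair_rowNl.
rewrite -[pair_row (grad g _) w']/(pderiv g w' (z + s%:C *: w)) -[pair_row _ w']/(pderiv g w' z).
have := hd s s0 sd.
rewrite [z + s%:C *: w' + s%:C *: w]addrAC.
set p := pderiv g w' (_ + _); set q := pderiv g w' z; set P := pderiv (pderiv _ _) _ _.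
set g2 := g (_ + _ + _); set g1 := g (z + s%:C *: w); set g1' := g (z + s%:C *: w').
move=> h1 h2.
have -> : g2 - g1 - g1' + g z - s%:C ^+ 2 * P =
  (g2 - g1' - (g1 - g z) - s%:C * (p - q)) + s%:C * (p - q - s%:C * P) by ring.
apply: le_trans (absc_triangle _ _) _.
rewrite [absc (s%:C * _)]abscM absc_real gtr0_norm //.
have h1' := ler_wpM2l (ltW s0) h1.
have h2' : absc (g2 - g1' - (g1 - g z) - s%:C * (p - q)) <= K * s * s ^+ 2.
  apply: le_trans h2 _; rewrite le_eqVlt; apply/orP; left; apply/eqP.
  by rewrite /K; field; rewrite gt_eqF.
have := ler_wpM2r (sqr_ge0 s) sK.
move: h1' h2'; rewrite [s * (_ * _)]mulrCA -expr2; lra.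
Qed.

(** Both sides are the limit of one second difference, symmetric in w and w', divided by s^2. *)
Theorem pderivC g w w' z : hol g ->
  pderiv (pderiv g w') w z = pderiv (pderiv g w) w' z.
Proof.
move=> hg; apply/eqP; rewrite -subr_eq0 -absc_eq0 eq_le absc_ge0 andbT.
apply/ler_addgt0Pr => e e0; have e2 : 0 < e / 2 by rewrite divr_gt0.
have [r r0 hr] := second_difference z w w' hg e2.
have [r' r0' hr'] := second_difference z w' w hg e2.
pose m := Num.min r r'; have m0 : 0 < m by rewrite lt_min r0.
pose s := m / 2; have s0 : 0 < s by rewrite divr_gt0.
have : s < m by rewrite /s; lra.
rewrite lt_min => /andP[/(hr s s0) h /(hr' s s0)].
rewrite [z + s%:C *: w' + s%:C *: w]addrAC => h'.
have s2 : 0 < s ^+ 2 by rewrite exprn_gt0.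
rewrite add0r -(ler_pM2r s2) -{1}(gtr0_norm s2) -absc_real -abscM rmorphXn /=.
move: h h'; set P := pderiv _ _ _; set P' := pderiv (pderiv g w) _ _.
set A := g _; set B := g (z + _); set B' := g (z + _) => h h'.
have -> : (P - P') * s%:C ^+ 2 = (A - B' - B + g z - s%:C ^+ 2 * P') -
  (A - B - B' + g z - s%:C ^+ 2 * P) by ring.
apply: le_trans (absc_triangleB _ _) _; move: h h'; lra.
Qed.

End HolomorphicDerivatives.

(** * From differentiability over [R[i]] to explicit estimates *)

Section Bridge.
Context {R : realType} {n : nat}.

Lemma mx_norm_le_nv (h : 'cV[R[i]]_n) : mx_norm h <= (nv h)%:C.
Proof.
have [->|/mx_norm_neq0[[k j] /= ->]] := eqVneq (mx_norm h) 0.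
  by rewrite lecR nv_ge0.
by rewrite ord1 normr_absc lecR nv_coord.
Qed.

Lemma holomorphic_hol (g : 'cV[R[i]]_n -> R[i]) : holomorphic g -> hol g.
Proof.
move=> hg z; pose C : numFieldType := R[i].
pose gC : 'cV[C]_n -> C^o := g; pose zC : 'cV[C]_n := z.
have dg : differentiable gC zC := hg z.
exists (\row_k ('d gC zC (delta_mx k 0) : C)) => e e0.
have /diff_locallyP[_] := dg.
move=> /eqaddoP/(_ e%:C); rewrite ltcR => /(_ e0) /nbhs_ballP[r /= r0 hr].
(* The radius lives in [R[i]]; being positive, it is real. *)
have [r' rr'] : exists r' : R, r = r'%:C.
  by exists (complex.Re r); rewrite RRe_real // gtr0_real.
move: r0 hr; rewrite {}rr' ltcR => r0 hr; exists r' => // h hlt.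
have := hr h; rewrite mx_norm_ball /ball_ /= sub0r normrN => /(_ _).
have -> : `|h : 'cV[C]_n| = mx_norm h by [].
have hb := mx_norm_le_nv h.
rewrite (le_lt_trans hb) ?ltcR // => /(_ isT).
move=> hh.
have {hh} : `|g (h + z) - (g z + ('d gC zC h : C))| <= e%:C * mx_norm h by exact: hh.
rewrite [h + z]addrC.
have -> : ('d gC zC h : C) = pair_row (\row_k ('d gC zC (delta_mx k 0) : C)) h.
  rewrite pair_rowE {1}(matrix_sum_delta h) linear_sum; apply: eq_bigr => k _.
  by rewrite big_ord1 linearZ mxE /= mulrC.
rewrite opprD addrA => /le_trans/(_ (ler_wpM2l _ hb)).
by rewrite -rmorphM normr_absc !lecR; apply; rewrite ltW.
Qed.

End Bridge.

(** * Real differentials from quadratic remainders *)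

Section RealDifferentials.
Context {R : realType}.

Lemma row_entry_le p (u : 'rV[R]_p) i : `|u 0 i| <= `|u|.
Proof.
have -> : `|u| = mx_norm u by [].
by rewrite mx_normrE (le_bigmax _ (fun ij => `|u ij.1 ij.2|) (0, i)).
Qed.

Lemma row_norm_le p (u : 'rV[R]_p) (B : R) : 0 <= B ->
  (forall i, `|u 0 i| <= B) -> `|u| <= B.
Proof.
have -> : `|u| = mx_norm u by [].
have [->|/mx_norm_neq0[[k j] /= ->]] := eqVneq (mx_norm u) 0 => //.
by rewrite ord1.
Qed.

Lemma mulmxr_bound p q (L : 'M[R]_(p, q)) (u : 'rV[R]_p) :
  `|u *m L| <= (\sum_i \sum_j `|L i j|) * `|u|.
Proof.
apply: row_norm_le => [|j].
  by rewrite mulr_ge0 // sumr_ge0 // => *; rewrite sumr_ge0.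
rewrite mxE (le_trans (ler_norm_sum _ _ _)) // mulr_suml ler_sum // => i _.
rewrite normrM mulrC ler_pM ?row_entry_le //.
by rewrite (bigD1 j) //= lerDl sumr_ge0.
Qed.

Lemma mulmxr_continuous p q (L : 'M[R]_(p, q)) :
  continuous (mulmxr L : 'rV[R]_p -> 'rV[R]_q).
Proof.
apply/(@linear_bounded_continuous R _ _ (mulmxr L : {linear 'rV[R]_p -> 'rV[R]_q})).
apply/linear_boundedP; exists (\sum_i \sum_j `|L i j|); split => [|B hB u /=].
  exact: num_real.
by apply: le_trans (mulmxr_bound L u) _; rewrite ler_wpM2r // ltW.
Qed.

Lemma quadratic_remainder_diff (V W : normedModType R) (F : V -> W) (x : V)
    (L : {linear V -> W}) (C r : R) : continuous L -> 0 < r ->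
  (forall h : V, `|h| < r -> `|F (x + h) - F x - L h| <= C * `|h| ^+ 2) ->
  differentiable F x /\ 'd F x = L :> (V -> W).
Proof.
move=> cL r0 hF.
have eo : F \o shift x = cst (F x) + L +o_0 id.
  apply/eqaddoP => e e0.
  pose C' := `|C| + 1; have C0 : 0 < C' by rewrite ltr_wpDl.
  apply/nbhs_normP; exists (Num.min r (e / C')) => /=.
    by rewrite lt_min r0 divr_gt0.
  move=> h; rewrite /= sub0r normrN lt_min => /andP[hr he].
  have := hF h hr; rewrite [x + h]addrC => hh.
  have -> : (F \o shift x - (cst (F x) + L)) h = F (h + x) - F x - L h.
    by rewrite opprD addrA.
  apply: le_trans hh _; rewrite expr2 mulrA ler_wpM2r //.
  move: he; rewrite ltr_pdivlMr // => /ltW; apply: le_trans.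
  by rewrite mulrC ler_wpM2l // /C' (le_trans (ler_norm C)) // lerDl.
have dE := diff_unique cL eo.
by split=> //; apply/diff_locallyP; rewrite dE.
Qed.

Lemma quadratic_remainder_jacobian p q (F : 'rV[R]_p -> 'rV[R]_q) (x : 'rV[R]_p)
    (L : 'M[R]_(p, q)) (C r : R) : 0 < r -> (forall h : 'rV[R]_p, `|h| < r ->
      `|F (x + h) - F x - h *m L| <= C * `|h| ^+ 2) ->
  differentiable F x /\ 'J F x = L.
Proof.
move=> r0 hF.
have [dF dE] := @quadratic_remainder_diff _ _ F x
  (mulmxr L : {linear 'rV[R]_p -> 'rV[R]_q}) C r (@mulmxr_continuous _ _ L) r0 hF.
split=> //; apply/row_matrixP => i; rewrite !rowE /jacobian mul_rV_lin1.
by rewrite dE.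
Qed.

End RealDifferentials.

(** * Wirtinger derivatives and the real Hessian *)

Section Wirtinger.
Context {R : realType}.

(** Matches [real_deriv] while also asserting that the derivatives exist, which the value of
    [derive1] does not. *)
Definition has_rderiv (phi : R -> R[i]) (c : R[i]) :=
  is_derive (0 : R) 1 (fun t => complex.Re (phi t)) (complex.Re c) /\
  is_derive (0 : R) 1 (fun t => complex.Im (phi t)) (complex.Im c).

Lemma has_rderivM phi psi c d : has_rderiv phi c -> has_rderiv psi d ->
  has_rderiv (fun t => phi t * psi t) (c * psi 0 + phi 0 * d).
Proof.
move=> [? ?] [? ?]; split.
  rewrite (_ : (fun t => _) = (fun t => complex.Re (phi t) * complex.Re (psi t)
    - complex.Im (phi t) * complex.Im (psi t))); last first.
    by apply: funext => t; rewrite ReM.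
  apply: is_derive_eq; rewrite ReD !ReM /GRing.scale /=; ring.
rewrite (_ : (fun t => _) = (fun t => complex.Re (phi t) * complex.Im (psi t)
  + complex.Im (phi t) * complex.Re (psi t))); last first.
  by apply: funext => t; rewrite ImM.
by apply: is_derive_eq; rewrite ImD !ImM /GRing.scale /=; ring.
Qed.

Lemma has_rderiv_conj phi c : has_rderiv phi c -> has_rderiv (fun t => conjc (phi t)) (conjc c).
Proof.
case: c => a b [/= h1 h2]; split => /=.
  rewrite (_ : (fun t => _) = (fun t => complex.Re (phi t))) //.
  by apply: funext => t; case: (phi t).
rewrite (_ : (fun t => _) = - (fun t => complex.Im (phi t))).
  exact: is_deriveN.
by apply: funext => t /=; rewrite /GRing.opp /=; case: (phi t).
Qed.

Lemma has_rderiv_sum m (phi : 'I_m -> R -> R[i]) c :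
  (forall j, has_rderiv (phi j) (c j)) ->
  has_rderiv (fun t => \sum_j phi j t) (\sum_j c j).
Proof.
move=> h; split.
  rewrite (_ : (fun t => _) = \sum_j (fun t => complex.Re (phi j t))); last first.
    by apply: funext => t; rewrite fct_sumE (big_morph _ (@ReD R) (erefl _)).
  rewrite (big_morph _ (@ReD R) (erefl _)); apply: is_derive_sum => j.
  by have [] := h j.
rewrite (_ : (fun t => _) = \sum_j (fun t => complex.Im (phi j t))); last first.
  by apply: funext => t; rewrite fct_sumE (big_morph _ (@ImD R) (erefl _)).
rewrite (big_morph _ (@ImD R) (erefl _)); apply: is_derive_sum => j.
by have [] := h j.
Qed.

Lemma derive_along (V : normedModType R) (phi : V -> R) (x v : V) (c : R) :
  is_derive (0 : R) 1 (fun t => phi (x + t *: v)) c -> 'D_v phi x = c.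
Proof.
case=> _ <-; rewrite /derive; apply: (congr1 (fun f : R -> R => lim (f @ 0^')%classic)).
apply: funext => h /=; rewrite !addr0 scale0r addr0 [h *: v + x]addrC.
by rewrite (_ : h%:A = h) // /GRing.scale /= mulr1.
Qed.

Variable n : nat.
Implicit Types (g : 'cV[R[i]]_n -> R[i]) (z w : 'cV[R[i]]_n).

Lemma real_derivE F z w c : has_rderiv (fun t => F (z + t%:C *: w)) c ->
  real_deriv w F z = c.
Proof.
move=> [h1 h2]; apply: complexP; rewrite /real_deriv /= derive1E.
  by case: h1 => _ <-.
by case: h2 => _ <-.
Qed.

Lemma has_rderiv_hol g z w : hol g ->
  has_rderiv (fun t => g (z + t%:C *: w)) (pderiv g w z).
Proof.
move=> hg; have := @has_cderiv_line R n g z w 0 hg; rewrite scale0r addr0 => d.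
split; apply: eps_is_derive => e /d[r r0 hr]; exists r => // h hh;
  have := hr h%:C; rewrite absc_real !add0r rmorph0 => /(_ hh).
  move/(le_trans (abs_Re_le _)).
  by rewrite !ReB ReM /= mulr0 subr0.
move/(le_trans (abs_Im_le _)).
by rewrite !ImB ImM /= mulr0 add0r.
Qed.

Lemma pderivDw g z w w' : pderiv g (w + w') z = pderiv g w z + pderiv g w' z.
Proof. exact: pair_rowDr. Qed.

Lemma pderivZw g z c w : pderiv g (c *: w) z = c * pderiv g w z.
Proof. exact: pair_rowZr. Qed.

Lemma pderiv_coord g z w :
  pderiv g w z = \sum_k pderiv g (delta_mx k 0) z * w k 0.
Proof.
by rewrite /pderiv pair_rowE; apply: eq_bigr => k _; rewrite pair_row_delta.
Qed.

Variable m : nat.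
Implicit Types (p q : 'I_m -> 'cV[R[i]]_n -> R[i]).

(** This family contains f = [hsum g g] and is stable under both Wirtinger operators: d/dz
    differentiates p and d/dzbar differentiates q, so mixed second derivatives need no new
    computation. *)
Definition hsum p q z : R[i] := \sum_j p j z * conjc (q j z).

Lemma has_rderiv_hsum p q z w : (forall j, hol (p j)) -> (forall j, hol (q j)) ->
  has_rderiv (fun t => hsum p q (z + t%:C *: w))
   (\sum_j (pderiv (p j) w z * conjc (q j z) + p j z * conjc (pderiv (q j) w z))).
Proof.
move=> hp hq; apply: has_rderiv_sum => j.
have := has_rderivM (has_rderiv_hol z w (hp j)) (has_rderiv_conj (has_rderiv_hol z w (hq j))).
by rewrite /= rmorph0 scale0r addr0.
Qed.

Lemma conj_iM (a : R[i]) : conjc ('i * a) = - 'i * conjc a.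
Proof. by case: a => x y; apply: complexP => /=; ring. Qed.

(** Passing from e_k to i e_k multiplies the derivative of p by i and that of conj q by -i. In d/dz
    the factors 1 - i i = 2 and 1 + i i = 0 keep the first and kill the second; d/dzbar exchanges
    them. *)
Lemma dz_hsum p q k : (forall j, hol (p j)) -> (forall j, hol (q j)) ->
  dz k (hsum p q) = hsum (fun j => pderiv (p j) (delta_mx k 0)) q.
Proof.
move=> hp hq; apply: funext => z; rewrite /dz /partial_x /partial_y.
rewrite !(real_derivE (has_rderiv_hsum z _ hp hq)) /hsum.
rewrite mulr_sumr -sumrB mulr_sumr; apply: eq_bigr => j _.
rewrite !pderivZw conj_iM.
have i2 : ('i : R[i]) * 'i = -1 by rewrite -expr2 sqr_i.
set P := pderiv _ _ _; set Q := conjc (pderiv _ _ _); set a := p j z; set b := conjc (q j z).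
have -> : P * b + a * Q - 'i * ('i * P * b + a * (- 'i * Q)) =
  P * b * (1 - 'i * 'i) + a * Q * (1 + 'i * 'i) by ring.
by rewrite i2; field.
Qed.

Lemma dzbar_hsum p q k : (forall j, hol (p j)) -> (forall j, hol (q j)) ->
  dzbar k (hsum p q) = hsum p (fun j => pderiv (q j) (delta_mx k 0)).
Proof.
move=> hp hq; apply: funext => z; rewrite /dzbar /partial_x /partial_y.
rewrite !(real_derivE (has_rderiv_hsum z _ hp hq)) /hsum.
rewrite mulr_sumr -big_split mulr_sumr; apply: eq_bigr => j _ /=.
rewrite !pderivZw conj_iM.
have i2 : ('i : R[i]) * 'i = -1 by rewrite -expr2 sqr_i.
set P := pderiv _ _ _; set Q := conjc (pderiv _ _ _); set a := p j z; set b := conjc (q j z).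
have -> : P * b + a * Q + 'i * ('i * P * b + a * (- 'i * Q)) =
  P * b * (1 + 'i * 'i) + a * Q * (1 - 'i * 'i) by ring.
by rewrite i2; field.
Qed.

Lemma sum_sq_normE p : sum_sq_norm p = hsum p p.
Proof. by apply: funext => z; apply: eq_bigr => j _; rewrite sqr_normc. Qed.

Lemma grad_zbarE p z : (forall j, hol (p j)) -> grad_zbar (sum_sq_norm p) z =
  \col_k hsum p (fun j => pderiv (p j) (delta_mx k 0)) z.
Proof.
move=> hp; rewrite sum_sq_normE; apply/matrixP => k i; rewrite !mxE.
by rewrite dzbar_hsum.
Qed.

Lemma mixed_hessianE p z : (forall j, hol (p j)) ->
  mixed_hessian (sum_sq_norm p) z = \matrix_(k, l)
    hsum (fun j => pderiv (p j) (delta_mx l 0)) (fun j => pderiv (p j) (delta_mx k 0)) z.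
Proof.
move=> hp; rewrite sum_sq_normE; apply/matrixP => k l; rewrite !mxE.
rewrite dz_hsum // dzbar_hsum // => j; exact: hol_pderiv.
Qed.

End Wirtinger.

(** * The real Hessian as a bilinear form *)

Section RealHessian.
Context {R : realType} {n : nat}.
Implicit Types (u v : 'rV[R]_(n + n)) (z w : 'cV[R[i]]_n).

Lemma of_realK z : of_real (to_real z) = z.
Proof.
apply/matrixP => k j; rewrite ord1 /of_real /to_real mxE row_mxEl row_mxEr !mxE.
by case: (z k 0).
Qed.

Lemma to_realK u : to_real (of_real u) = u.
Proof.
apply/rowP => k; rewrite mxE; case: splitP => j kj; rewrite !mxE /=;
  by congr (u 0 _); apply: val_inj.
Qed.

Lemma of_realD u v : of_real (u + v) = of_real u + of_real v.
Proof. by apply/matrixP => k j; rewrite !mxE; apply: complexP; rewrite ?ReD ?ImD. Qed.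

Lemma of_realZ (a : R) u : of_real (a *: u) = a%:C *: of_real u.
Proof.
by apply/matrixP => k j; rewrite !mxE; apply: complexP => /=; ring.
Qed.

Lemma of_real_sum (I : finType) (u : I -> 'rV[R]_(n + n)) :
  of_real (\sum_i u i) = \sum_i of_real (u i).
Proof.
apply: (big_morph _ of_realD).
by rewrite -(scale0r (0 : 'rV[R]_(n + n))) of_realZ rmorph0 scale0r.
Qed.

Lemma to_realD z w : to_real (z + w) = to_real z + to_real w.
Proof. by rewrite -[z]of_realK -[w]of_realK -of_realD !to_realK. Qed.

Lemma to_realZ (a : R) z : to_real (a%:C *: z) = a *: to_real z.
Proof. by rewrite -[z]of_realK -of_realZ !to_realK. Qed.

Lemma to_realN z : to_real (- z) = - to_real z.
Proof. by rewrite -[RHS]scaleN1r -to_realZ rmorphN1 scaleN1r. Qed.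

Lemma to_real_pairing z w :
  (to_real z *m (to_real w)^T) 0 0 = complex.Re (\sum_k conjc (z k 0) * w k 0).
Proof.
rewrite mxE big_split_ord /= (big_morph _ (@ReD R) (erefl _)) -big_split /=.
apply: eq_bigr => k _; rewrite ![_^T _ _]mxE /to_real !row_mxEl !row_mxEr !mxE.
by rewrite ReM; case: (z k 0) => a b; case: (w k 0) => c d /=; ring.
Qed.

Lemma real_linear_mulmx p q (phi : 'rV[R]_p -> 'rV[R]_q) :
  (forall x y, phi (x + y) = phi x + phi y) ->
  (forall (a : R) x, phi (a *: x) = a *: phi x) ->
  forall x, phi x = x *m (\matrix_k phi (delta_mx 0 k)).
Proof.
move=> hD hZ x; rewrite mulmx_sum_row {1}[x]row_sum_delta.
have phi0 : phi 0 = 0 by rewrite -[X in phi X](scale0r 0) hZ scale0r.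
rewrite (big_morph phi hD phi0); apply: eq_bigr => i _.
by rewrite hZ rowK.
Qed.

Variable m : nat.
Variable g : 'I_m -> 'cV[R[i]]_n -> R[i].
Hypothesis hg : forall j, hol (g j).
Variable z0 : 'cV[R[i]]_n.

(** The second derivative of f at z0 along w, then w': the derivative of f along w is 2 Re of the
    sum of (d_w g_j) conj g_j. *)
Definition hess_form w' w : R := 2 * complex.Re (\sum_j
  (pderiv (pderiv (g j) w) w' z0 * conjc (g j z0)
   + pderiv (g j) w z0 * conjc (pderiv (g j) w' z0))).

Lemma Re_conj (a : R[i]) : complex.Re (conjc a) = complex.Re a.
Proof. by case: a. Qed.

Lemma conj_realM (a : R) (x : R[i]) : conjc (a%:C * x) = a%:C * conjc x.
Proof. by case: x => b c; apply: complexP => /=; ring. Qed.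

Lemma hess_formC w w' : hess_form w' w = hess_form w w'.
Proof.
congr (2 * _); rewrite !(big_morph _ (@ReD R) (erefl _)); apply: eq_bigr => j _.
rewrite !ReD pderivC //; congr (_ + _).
by rewrite -[LHS]Re_conj rmorphM /= conjcK mulrC.
Qed.

Lemma hess_formD w' w1 w2 : hess_form (w1 + w2) w' = hess_form w1 w' + hess_form w2 w'.
Proof.
rewrite -mulrDr -ReD -big_split /=; congr (2 * complex.Re _).
by apply: eq_bigr => j _; rewrite !pderivDw rmorphD /=; ring.
Qed.

Lemma hess_formZ (a : R) w w' : hess_form (a%:C *: w) w' = a * hess_form w w'.
Proof.
rewrite mulrCA; congr (2 * _).
have -> : a * complex.Re (\sum_j (pderiv (pderiv (g j) w') w z0 * conjc (g j z0)
   + pderiv (g j) w' z0 * conjc (pderiv (g j) w z0))) =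
  complex.Re (a%:C * \sum_j (pderiv (pderiv (g j) w') w z0 * conjc (g j z0)
   + pderiv (g j) w' z0 * conjc (pderiv (g j) w z0))).
  by rewrite ReM /= mul0r subr0.
rewrite mulr_sumr; congr complex.Re; apply: eq_bigr => j _.
by rewrite !pderivZw conj_realM; ring.
Qed.

(** An equality of functions, as the result is differentiated once more. *)
Lemma derive_sum_sq_norm v : 'D_v (fun u => complex.Re (sum_sq_norm g (of_real u))) =
  (fun u => 2 * complex.Re (hsum (fun j => pderiv (g j) (of_real v)) g (of_real u))).
Proof.
apply: funext => u; apply: derive_along; rewrite sum_sq_normE.
have [] := has_rderiv_hsum (of_real u) (of_real v) hg hg.
rewrite (_ : (fun t => _) =
    (fun t : R => complex.Re (hsum g g (of_real (u + t *: v))))); last first.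
  by apply: funext => t; rewrite of_realD of_realZ.
move=> h _; apply: (is_derive_eq h); rewrite /hsum.
rewrite !(big_morph _ (@ReD R) (erefl _)) mulr_sumr; apply: eq_bigr => j _.
rewrite ReD -[X in _ + X]Re_conj rmorphM /= conjcK [conjc _ * _]mulrC; ring.
Qed.

Lemma real_hessian_entry k l : real_hessian (sum_sq_norm g) z0 k l =
  hess_form (of_real (delta_mx 0 k)) (of_real (delta_mx 0 l)).
Proof.
rewrite mxE derive_sum_sq_norm; apply: derive_along.
have hp (j : 'I_m) := hol_pderiv (of_real (delta_mx 0 l)) (@hg j).
have [h _] := has_rderiv_hsum (of_real (to_real z0)) (of_real (delta_mx 0 k)) hp hg.
rewrite of_realK in h.
rewrite (_ : (fun t => _) = (fun t : R => 2 * complex.Re (hsum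
   (fun j => pderiv (g j) (of_real (delta_mx 0 l))) g
   (z0 + t%:C *: of_real (delta_mx 0 k))))); last first.
  by apply: funext => t; rewrite of_realD of_realZ of_realK.
by apply: is_derive_eq; rewrite /GRing.scale /=.
Qed.

Lemma real_hessian_sym : (real_hessian (sum_sq_norm g) z0)^T = real_hessian (sum_sq_norm g) z0.
Proof. by apply/matrixP => k l; rewrite mxE !real_hessian_entry hess_formC. Qed.

Lemma hess_form_suml (I : finType) (w : I -> 'cV[R[i]]_n) w' :
  hess_form (\sum_i w i) w' = \sum_i hess_form (w i) w'.
Proof.
apply: (big_morph (hess_form^~ w') (hess_formD w')).
rewrite -[X in hess_form X](scale0r (0 : 'cV[R[i]]_n)).
by rewrite -(rmorph0 (real_complex R)) hess_formZ mul0r.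
Qed.

Lemma real_hessian_form u v :
  (u *m real_hessian (sum_sq_norm g) z0 *m v^T) 0 0 =
  hess_form (of_real u) (of_real v).
Proof.
have decomp (x : 'rV[R]_(n + n)) : of_real x = \sum_k (x 0 k)%:C *: of_real (delta_mx 0 k).
  by rewrite [in LHS](row_sum_delta x) of_real_sum; apply: eq_bigr => k _; rewrite of_realZ.
rewrite (decomp u) hess_form_suml -mulmxA mxE; apply: eq_bigr => k _.
rewrite hess_formZ; congr (_ * _); rewrite hess_formC (decomp v) hess_form_suml mxE.
by apply: eq_bigr => l _; rewrite hess_formZ hess_formC real_hessian_entry mxE mulrC.
Qed.

(** The real differential of the conjugate gradient at z0, that is B w + A conj w. *)
Definition lin_grad w : 'cV[R[i]]_n := \col_k \sum_j
  (pderiv (g j) w z0 * conjc (pderiv (g j) (delta_mx k 0) z0)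
   + g j z0 * conjc (pderiv (pderiv (g j) (delta_mx k 0)) w z0)).

(** Summing over coordinates reassembles the derivative along w', once [pderivC] has moved the
    coordinate direction outside. *)
Lemma lin_grad_pairing w w' :
  2 * complex.Re (\sum_k conjc (w' k 0) * lin_grad w k 0) = hess_form w' w.
Proof.
congr (2 * _).
transitivity (complex.Re (\sum_j (pderiv (g j) w z0 * conjc (pderiv (g j) w' z0)
   + g j z0 * conjc (pderiv (pderiv (g j) w) w' z0)))).
  congr complex.Re; under eq_bigr do rewrite mxE mulr_sumr.
  rewrite exchange_big /=; apply: eq_bigr => j _.
  rewrite (pderiv_coord (g j) z0 w') (pderiv_coord (pderiv (g j) w) z0 w').
  rewrite !rmorph_sum !mulr_sumr -big_split /=; apply: eq_bigr => k _.
  by rewrite (pderivC w _ z0 (@hg j)) !rmorphM /=; ring.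
rewrite !(big_morph _ (@ReD R) (erefl _)); apply: eq_bigr => j _.
by rewrite !ReD addrC; congr (_ + _); rewrite -[LHS]Re_conj rmorphM /= conjcK mulrC.
Qed.

(** In real coordinates d/dzbar is half the real gradient, so its differential is half the
    Hessian. *)
Lemma to_real_lin_grad u :
  to_real (lin_grad (of_real u)) = 2^-1 *: (u *m real_hessian (sum_sq_norm g) z0).
Proof.
apply/rowP => l; rewrite [RHS]mxE.
have -> : (u *m real_hessian (sum_sq_norm g) z0) 0 l =
    (u *m real_hessian (sum_sq_norm g) z0 *m (delta_mx 0 l : 'rV[R]_(n + n))^T) 0 0.
  by rewrite trmx_delta -colE [RHS]mxE.
rewrite real_hessian_form hess_formC -lin_grad_pairing.
rewrite mulrA mulVf // mul1r -to_real_pairing to_realK [RHS]mxE.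
rewrite (bigD1 l) //= big1 => [|k kl]; rewrite ![delta_mx _ _ _ _]mxE ?eqxx.
  by rewrite mul1r addr0 [RHS]mxE.
by rewrite (negPf kl) mul0r.
Qed.

End RealHessian.

(** * Expansions at a point *)

Section Expansions.
Context {R : realType} {n : nat}.
Variable z0 : 'cV[R[i]]_n.
Implicit Types (F G : 'cV[R[i]]_n -> R[i]) (l : 'cV[R[i]]_n -> R[i]).

Definition lip_at F := exists C r : R, [/\ 0 <= C, 0 < r &
  forall h, nv h <= r -> absc (F (z0 + h) - F z0) <= C * nv h].

Definition second_order_at F l := exists C r : R, [/\ 0 <= C, 0 < r &
  forall h, nv h <= r -> absc (F (z0 + h) - F z0 - l h) <= C * nv h ^+ 2].

Lemma lip_at_cst (c : R[i]) : lip_at (fun=> c).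
Proof. by exists 0, 1; split=> // h _; rewrite subrr absc0 mul0r. Qed.

Lemma lip_atD F G : lip_at F -> lip_at G -> lip_at (fun z => F z + G z).
Proof.
move=> [C [r [C0 r0 hF]]] [D [s [D0 s0 hG]]]; exists (C + D), (Num.min r s).
split; [exact: addr_ge0|by rewrite lt_min r0|move=> h].
rewrite le_min => /andP[/hF hf /hG hg]; rewrite opprD addrACA.
by apply: le_trans (absc_triangle _ _) _; rewrite mulrDl lerD.
Qed.

Lemma lip_atM F G : lip_at F -> lip_at G -> lip_at (fun z => F z * G z).
Proof.
move=> [C [r [C0 r0 hF]]] [D [s [D0 s0 hG]]].
(* The radius 1 turns the quadratic product of increments into a linear bound. *)
exists (C * absc (G z0) + absc (F z0) * D + C * D), (Num.min 1 (Num.min r s)).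
split; first by rewrite !addr_ge0 ?mulr_ge0 ?absc_ge0.
  by rewrite !lt_min ltr01 r0.
move=> h; rewrite !le_min => /andP[h1 /andP[/hF hf /hG hg]].
have -> : F (z0 + h) * G (z0 + h) - F z0 * G z0 = (F (z0 + h) - F z0) * G z0
  + F z0 * (G (z0 + h) - G z0) + (F (z0 + h) - F z0) * (G (z0 + h) - G z0) by ring.
apply: le_trans (absc_triangle _ _) _; rewrite [leRHS]mulrDl lerD //.
  apply: le_trans (absc_triangle _ _) _; rewrite !abscM mulrDl lerD //.
    by rewrite mulrAC ler_wpM2r ?absc_ge0.
  by rewrite -mulrA ler_wpM2l ?absc_ge0.
rewrite abscM (le_trans (ler_pM _ _ hf hg)) ?absc_ge0 // mulrACA.
by rewrite ler_wpM2l ?mulr_ge0 // ler_piMl ?nv_ge0.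
Qed.

Lemma lip_at_conj F : lip_at F -> lip_at (fun z => conjc (F z)).
Proof.
move=> [C [r [C0 r0 hF]]]; exists C, r; split => // h /hF.
by rewrite -rmorphB /= absc_conj.
Qed.

Lemma lip_at_sum (I : Type) (s : seq I) (F : I -> 'cV[R[i]]_n -> R[i]) :
  (forall i, lip_at (F i)) -> lip_at (fun z => \sum_(i <- s) F i z).
Proof.
move=> hF; elim: s => [|i s IH].
  rewrite (_ : (fun z => _) = fun=> 0); first exact: lip_at_cst.
  by apply: funext => z; rewrite big_nil.
rewrite (_ : (fun z => _) = fun z => F i z + \sum_(i <- s) F i z).
  exact: lip_atD.
by apply: funext => z; rewrite big_cons.
Qed.

Lemma lip_at_prod (I : Type) (s : seq I) (F : I -> 'cV[R[i]]_n -> R[i]) :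
  (forall i, lip_at (F i)) -> lip_at (fun z => \prod_(i <- s) F i z).
Proof.
move=> hF; elim: s => [|i s IH].
  rewrite (_ : (fun z => _) = fun=> 1); first exact: lip_at_cst.
  by apply: funext => z; rewrite big_nil.
rewrite (_ : (fun z => _) = fun z => F i z * \prod_(i <- s) F i z).
  exact: lip_atM.
by apply: funext => z; rewrite big_cons.
Qed.

Lemma lip_atV F : F z0 != 0 -> lip_at F -> lip_at (fun z => (F z)^-1).
Proof.
(* Near z0 the modulus of F stays above a, half its value at z0. *)
move=> F0 [C [r [C0 r0 hF]]]; pose a := absc (F z0) / 2.
have aF : 0 < absc (F z0) by rewrite absc_gt0.
have a0 : 0 < a by rewrite divr_gt0.
have C1 : 0 < C + 1 by rewrite ltr_wpDl.
exists (C / (a * absc (F z0))), (Num.min r (a / (C + 1))).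
split; first by rewrite divr_ge0 // mulr_ge0 ?absc_ge0 // ltW.
  by rewrite lt_min r0 divr_gt0.
move=> h; rewrite le_min => /andP[/hF hf ha].
have hC : C * nv h <= a.
  by apply: le_trans (small_quotient C0 a0); rewrite ler_wpM2l.
have Fa : a <= absc (F (z0 + h)).
  have := absc_triangleB (F (z0 + h)) (F (z0 + h) - F z0).
  by rewrite subKr /a; rewrite /a in hC; lra.
have Fh : F (z0 + h) != 0 by rewrite -absc_gt0 (lt_le_trans a0).
have -> : (F (z0 + h))^-1 - (F z0)^-1 =
  - ((F (z0 + h) - F z0) / (F (z0 + h) * F z0)) by field; rewrite F0.
rewrite abscN abscM abscV abscM mulrAC ler_pM ?absc_ge0 //.
  by rewrite invr_ge0 mulr_ge0 ?absc_ge0.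
have Fh0 : 0 < absc (F (z0 + h)) := lt_le_trans a0 Fa.
by rewrite lef_pV2 ?posrE ?mulr_gt0 // ler_wpM2r ?absc_ge0.
Qed.

Lemma lip_at_det d (A : 'cV[R[i]]_n -> 'M[R[i]]_d) :
  (forall i j, lip_at (fun z => A z i j)) -> lip_at (fun z => \det (A z)).
Proof.
move=> hA; apply: lip_at_sum => s; apply: lip_atM; first exact: lip_at_cst.
exact: lip_at_prod.
Qed.

(** Cramer's rule reduces to determinants. Invertibility at every z keeps [invmx] on its cofactor
    branch. *)
Lemma lip_at_invmx d (A : 'cV[R[i]]_n -> 'M[R[i]]_d) i j :
  (forall z, A z \in unitmx) -> (forall i j, lip_at (fun z => A z i j)) ->
  lip_at (fun z => invmx (A z) i j).
Proof.
move=> uA hA; rewrite (_ : (fun z => _) = fun z => (\det (A z))^-1 *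
    ((-1) ^+ (j + i) * \det (row' j (col' i (A z))))); last first.
  by apply: funext => z; rewrite /invmx uA !mxE /cofactor.
apply: lip_atM.
  apply: lip_atV; last exact: lip_at_det.
  by have := uA z0; rewrite unitmxE unitfE.
apply: lip_atM; first exact: lip_at_cst.
apply: lip_at_det => k l.
rewrite (_ : (fun z => _) = fun z => A z (lift j k) (lift i l)) //.
by apply: funext => z; rewrite !mxE.
Qed.

Lemma hol_lip_at F : hol F -> lip_at F.
Proof.
move=> hF; have [r r0 [M M0 hM]] := hol_locally_bounded z0 hF.
exists (8 * M / (r / 2)), (r / 2); split; rewrite ?divr_gt0 //.
  by rewrite divr_ge0 ?mulr_ge0 // ltW // divr_gt0.
move=> h hh; rewrite -{2}[h](addrK z0) [h + z0]addrC.
apply: (@holomorphic_lip R n F z0) => //; rewrite ?divr_gt0 //.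
- by move=> y hy; apply: hM; move: hy; lra.
- by rewrite subrr nv0 ltW // divr_gt0.
- by rewrite addrAC subrr add0r.
Qed.

Lemma hol_second_order_at F : hol F -> second_order_at F (fun h => pderiv F h z0).
Proof.
move=> hF; have [r0 r00 [M M0 hM]] := hol_locally_bounded z0 hF.
pose r := r0 / 6; have rp : 0 < r by rewrite divr_gt0.
exists (22 * M / r ^+ 2), r; split => //.
  by rewrite divr_ge0 ?sqr_ge0 ?mulr_ge0.
move=> h hh; apply: (@taylor1 R n F z0) => //.
  by move=> y hy; apply: hM; move: hy; rewrite /r; lra.
by rewrite subrr nv0 ltW.
Qed.

Lemma second_order_at_ext F F' l l' : F =1 F' -> l =1 l' ->
  second_order_at F' l' -> second_order_at F l.
Proof. by move=> /funext-> /funext->. Qed.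

Lemma second_order_at_conj F l : second_order_at F l ->
  second_order_at (fun z => conjc (F z)) (fun h => conjc (l h)).
Proof.
move=> [C [r [C0 r0 hF]]]; exists C, r; split => // h /hF.
by rewrite -!rmorphB /= absc_conj.
Qed.

Lemma second_order_at_linear l : (forall z h, l (z + h) = l z + l h) ->
  second_order_at l l.
Proof.
move=> hl; exists 0, 1; split=> // h _.
by rewrite hl [l z0 + l h]addrC addrK subrr absc0 mul0r.
Qed.

Lemma second_order_atD F G l l' : second_order_at F l -> second_order_at G l' ->
  second_order_at (fun z => F z + G z) (fun h => l h + l' h).
Proof.
move=> [C [r [C0 r0 hF]]] [D [s [D0 s0 hG]]]; exists (C + D), (Num.min r s).
split; [exact: addr_ge0|by rewrite lt_min r0|move=> h].
rewrite le_min => /andP[/hF hf /hG hg].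
have -> : F (z0 + h) + G (z0 + h) - (F z0 + G z0) - (l h + l' h) =
  (F (z0 + h) - F z0 - l h) + (G (z0 + h) - G z0 - l' h) by ring.
by apply: le_trans (absc_triangle _ _) _; rewrite mulrDl lerD.
Qed.

Lemma second_order_atN F l : second_order_at F l ->
  second_order_at (fun z => - F z) (fun h => - l h).
Proof.
move=> [C [r [C0 r0 hF]]]; exists C, r; split => // h /hF.
by rewrite -!opprD abscN.
Qed.

Lemma second_order_at_sum (I : Type) (s : seq I) (F l : I -> 'cV[R[i]]_n -> R[i]) :
  (forall i, second_order_at (F i) (l i)) ->
  second_order_at (fun z => \sum_(i <- s) F i z) (fun h => \sum_(i <- s) l i h).
Proof.
move=> hF; elim: s => [|i s IH].
  exists 0, 1; split=> // h _; rewrite !big_nil !subr0 absc0 mul0r //.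
rewrite (_ : (fun z => _) = fun z => F i z + \sum_(i <- s) F i z); last first.
  by apply: funext => z; rewrite big_cons.
rewrite (_ : (fun h => \sum_(j <- i :: s) l j h) =
    fun h => l i h + \sum_(i <- s) l i h); last first.
  by apply: funext => z; rewrite big_cons.
exact: second_order_atD.
Qed.

Lemma second_order_atM F G l l' : lip_at F -> lip_at G ->
  second_order_at F l -> second_order_at G l' ->
  second_order_at (fun z => F z * G z) (fun h => l h * G z0 + F z0 * l' h).
Proof.
move=> [A [a [A0 a0 hA]]] [B [b [B0 b0 hB]]] [C [r [C0 r0 hF]]] [D [s [D0 s0 hG]]].
exists (C * absc (G z0) + absc (F z0) * D + A * B), (Num.min (Num.min a b) (Num.min r s)).
split; first by rewrite !addr_ge0 ?mulr_ge0 ?absc_ge0.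
  by rewrite !lt_min a0 b0 r0.
move=> h; rewrite !le_min => /andP[/andP[/hA ha /hB hb] /andP[/hF hf /hG hg]].
have -> : F (z0 + h) * G (z0 + h) - F z0 * G z0 - (l h * G z0 + F z0 * l' h) =
  (F (z0 + h) - F z0 - l h) * G z0 + F z0 * (G (z0 + h) - G z0 - l' h)
  + (F (z0 + h) - F z0) * (G (z0 + h) - G z0) by ring.
apply: le_trans (absc_triangle _ _) _; rewrite [leRHS]mulrDl lerD //.
  apply: le_trans (absc_triangle _ _) _; rewrite !abscM mulrDl lerD //.
    by rewrite mulrAC ler_wpM2r ?absc_ge0.
  by rewrite -mulrA ler_wpM2l ?absc_ge0.
rewrite abscM (le_trans (ler_pM _ _ ha hb)) ?absc_ge0 //.
by rewrite mulrACA -expr2.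
Qed.

(* At a zero of G, only F(z0) enters the linear part of F * G, so F need not be
   differentiable. *)
Lemma second_order_at_vanishing F G l : lip_at F -> lip_at G -> G z0 = 0 ->
  second_order_at G l -> second_order_at (fun z => F z * G z) (fun h => F z0 * l h).
Proof.
move=> [A [a [A0 a0 hA]]] [B [b [B0 b0 hB]]] Gz0 [D [s [D0 s0 hG]]].
exists (absc (F z0) * D + A * B), (Num.min (Num.min a b) s).
split; first by rewrite !addr_ge0 ?mulr_ge0 ?absc_ge0.
  by rewrite !lt_min a0 b0.
move=> h; rewrite !le_min => /andP[/andP[/hA ha /hB hb] /hG hg].
have -> : F (z0 + h) * G (z0 + h) - F z0 * G z0 - F z0 * l h =
  F z0 * (G (z0 + h) - G z0 - l h)
  + (F (z0 + h) - F z0) * (G (z0 + h) - G z0) by rewrite Gz0; ring.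
apply: le_trans (absc_triangle _ _) _; rewrite [leRHS]mulrDl lerD //.
  by rewrite abscM -mulrA ler_wpM2l ?absc_ge0.
rewrite abscM (le_trans (ler_pM _ _ ha hb)) ?absc_ge0 //.
by rewrite mulrACA -expr2.
Qed.

Lemma second_order_at_common d (F l : 'I_d -> 'cV[R[i]]_n -> R[i]) :
  (forall i, second_order_at (F i) (l i)) -> exists C r : R, [/\ 0 <= C, 0 < r &
    forall i h, nv h <= r -> absc (F i (z0 + h) - F i z0 - l i h) <= C * nv h ^+ 2].
Proof.
move=> hF; suff [C [r [C0 r0 h]]] : exists C r : R, [/\ 0 <= C, 0 < r &
    forall i, i \in enum 'I_d -> forall h, nv h <= r ->
      absc (F i (z0 + h) - F i z0 - l i h) <= C * nv h ^+ 2].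
  by exists C, r; split => // i; apply: h; rewrite mem_enum.
elim: (enum 'I_d) => [|i s [C [r [C0 r0 hs]]]]; first by exists 0, 1.
have [D [q [D0 q0 hi]]] := hF i; exists (C + D), (Num.min r q).
split; [exact: addr_ge0|by rewrite lt_min r0|move=> k].
rewrite in_cons => /orP[/eqP->|/hs {}hs] h; rewrite le_min => /andP[hr hq].
  by apply: le_trans (hi h hq) _; rewrite ler_wpM2r ?sqr_ge0 // lerDr.
by apply: le_trans (hs h hr) _; rewrite ler_wpM2r ?sqr_ge0 // lerDl.
Qed.

End Expansions.

(** * Spectra and signatures *)

Section QuadraticForms.
Context {R : realType} {d : nat}.
Implicit Types (M H S N : 'M[R]_d) (x y : 'rV[R]_d) (v : 'rV[R[i]]_d).

Definition qform M x : R := (x *m M *m x^T) 0 0.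

Local Notation cplx := (map_mx (real_complex R)).
Local Notation adj A := (map_mx Num.conj A^T).

Lemma conjC_real (a : R) : Num.conj (a%:C : R[i]) = a%:C.
Proof. exact: conjc_real. Qed.

Lemma adj_cplx p q (A : 'M[R]_(p, q)) : adj (cplx A) = cplx A^T.
Proof. by apply/matrixP => i j; rewrite !mxE conjC_real. Qed.

Lemma adjM p q r (A : 'M[R[i]]_(p, q)) (B : 'M[R[i]]_(q, r)) :
  adj (A *m B) = adj B *m adj A.
Proof. by rewrite trmx_mul map_mxM. Qed.

Lemma adjK p q (A : 'M[R[i]]_(p, q)) : adj (adj A) = A.
Proof. by apply/matrixP => i j; rewrite !mxE conjCK. Qed.

Lemma cplx_hermsym M : M^T = M -> cplx M \is hermsymmx.
Proof.
move=> MT; apply/is_hermitianmxP; rewrite expr0 scale1r.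
by rewrite adj_cplx MT.
Qed.

(** At v = x + i y the cross terms are i (y M x^T - x M y^T), which vanishes as M is symmetric. *)
Lemma qform_cplx M v : M^T = M ->
  (v *m cplx M *m adj v) 0 0 =
  (qform M (map_mx (@complex.Re R) v) + qform M (map_mx (@complex.Im R) v))%:C.
Proof.
move=> MT; set x := map_mx _ v; set y := map_mx _ v.
have vE : v = cplx x + 'i *: cplx y.
  by apply/rowP => k; rewrite !mxE; exact: complexE.
have avE : adj v = cplx x^T - 'i *: cplx y^T.
  apply/matrixP => k l; rewrite !mxE ord1 /=.
  by case: (v 0 k) => a b; apply: complexP => /=; ring.
rewrite avE vE !mulmxDl !mulmxBr -!scalemxAl -!scalemxAr -!map_mxM.
have sym : x *m M *m y^T = y *m M *m x^T.
  have tr11 (X : 'M[R]_1) : X^T = X by apply/matrixP => k l; rewrite mxE !ord1.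
  by rewrite -[LHS]tr11 !trmx_mul trmxK MT mulmxA.
rewrite sym /qform.
move: (x *m M *m x^T) (y *m M *m x^T) (y *m M *m y^T) => X Z Y.
rewrite !mxE rmorphD.
have i2 : ('i : R[i]) * 'i = -1 by rewrite -expr2; exact: sqr_i.
have ringE (a b c : R[i]) :
    a - 'i * c + ('i * c - 'i * ('i * b)) = a - ('i * 'i) * b by ring.
by rewrite ringE i2 mulN1r opprK.
Qed.

(** Write B = adj W W and diagonalize the hermitian W A adj W as adj U diag m U. Then Q = W^-1 adj U
    diagonalizes A by congruence, and the rows of U W are left eigenvectors of A B for the same m,
    which links the signature of A to the spectrum of A B. *)
Lemma simultaneous_diagonalization (A B : 'M[R[i]]_d) :
  A \is hermsymmx -> B \is hermsymmx ->
  (forall v, v != 0 -> 0 < (v *m B *m adj v) 0 0) ->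
  exists (Q : 'M[R[i]]_d) (m : 'rV[R[i]]_d), [/\ Q \in unitmx,
    A = Q *m diag_mx m *m adj Q,
    forall k, m 0 k \is Num.real & forall k, eigenvalue (A *m B) (m 0 k)].
Proof.
move=> Ah Bh Bpos.
have AE : A = adj A by have /is_hermitianmxP := Ah; rewrite expr0 scale1r.
have /hermitian_normalmx/orthomx_spectralP := Bh.
set V := spectralmx B; set s := spectral_diag B.
have Vu : V \is unitarymx := spectral_unitarymx B.
have Vun := unitarymx_unit Vu.
rewrite invmx_unitary // => BV.
have VV : V *m adj V = 1%:M by rewrite -invmx_unitary // mulmxV.
have VV' : adj V *m V = 1%:M by rewrite -invmx_unitary // mulVmx.
have delta_neq0 (X : 'M[R[i]]_d) k : X \in unitmx ->
    (delta_mx 0 k : 'rV[R[i]]_d) *m X != 0.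
  move=> uX; apply/eqP => /(congr1 (mulmx^~ (invmx X))).
  rewrite mulmxK // mul0mx => /rowP/(_ k); rewrite !mxE !eqxx => /eqP.
  by rewrite oner_eq0.
have delta_adj k : adj (delta_mx 0 k : 'rV[R[i]]_d) = delta_mx k 0.
  by apply/matrixP => i j; rewrite !mxE andbC conjC_nat.
have delta_diag (D : 'rV[R[i]]_d) k :
    (delta_mx 0 k : 'rV[R[i]]_d) *m diag_mx D = D 0 k *: delta_mx 0 k.
  rewrite -rowE row_diag_mx //.
have s0 k : 0 < s 0 k.
  have := Bpos _ (delta_neq0 V k Vun).
  rewrite BV adjM delta_adj !mulmxA -(mulmxA _ V (adj V)) VV mulmx1.
  rewrite -(mulmxA _ V (adj V)) VV mulmx1 delta_diag -scalemxAl mul_delta_mx !mxE.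
  by rewrite !eqxx mulr1.
(* A square root of B up to a unitary factor, from its positive spectrum s. *)
pose t := map_mx sqrtC s; pose W := diag_mx t *m V.
have t0 k : 0 < t 0 k by rewrite mxE sqrtC_gt0.
have tE : adj (diag_mx t) = diag_mx t.
  apply/matrixP => i j; rewrite !mxE eq_sym; case: eqVneq => [->|_].
    by rewrite !mulr1n; apply/CrealP/gtr0_real; rewrite sqrtC_gt0.
  by rewrite !mulr0n conjC0.
have Wun : W \in unitmx.
  rewrite unitmx_mul Vun andbT unitmxE det_diag unitfE.
  by apply/prodf_neq0 => k _; rewrite gt_eqF.
have WB : adj W *m W = B.
  rewrite adjM tE BV !mulmxA -(mulmxA _ (diag_mx t) (diag_mx t)); congr (_ *m _ *m _).
  rewrite mulmx_diag; congr diag_mx; apply/rowP => k.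
  by rewrite !mxE -expr2 sqrtCK.
clearbody W; have Mh : W *m A *m adj W \is hermsymmx.
  apply/is_hermitianmxP; rewrite expr0 scale1r.
  by rewrite !adjM adjK -AE mulmxA.
have /hermitian_normalmx/orthomx_spectralP := Mh.
have := hermitian_spectral_diag_real Mh.
set U := spectralmx _; set m := spectral_diag _ => mreal.
have Uu : U \is unitarymx := spectral_unitarymx _.
have Uun := unitarymx_unit Uu.
rewrite invmx_unitary // => MU.
have UU : U *m adj U = 1%:M by rewrite -invmx_unitary // mulmxV.
exists (invmx W *m adj U), m; split.
- by rewrite unitmx_mul unitmx_inv Wun -invmx_unitary // unitmx_inv.
- rewrite adjM adjK !mulmxA -(mulmxA (invmx W)) -(mulmxA (invmx W)) -MU.
  rewrite !mulmxA mulVmx // mul1mx -mulmxA -adjM mulVmx //.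
  by rewrite trmx1 map_mx1 mulmx1.
- by move=> k; apply: (mxOverP mreal).
- move=> k; apply/eigenvalueP; exists ((delta_mx 0 k) *m (U *m W)).
    rewrite -WB !mulmxA -(mulmxA _ W A) -(mulmxA _ (W *m A)) MU.
    by rewrite !mulmxA -(mulmxA _ U (adj U)) UU mulmx1 delta_diag -!scalemxAl.
  by apply: delta_neq0; rewrite unitmx_mul Uun.
Qed.

End QuadraticForms.

(** * Signs of a quadratic form read off a spectrum *)

Section Signature.
Context {R : realType} {d : nat}.
Implicit Types (M H S N L : 'M[R]_d) (x y : 'rV[R]_d) (v : 'rV[R[i]]_d).
Local Notation cplx := (map_mx (real_complex R)).
Local Notation adj A := (map_mx Num.conj A^T).

Lemma ReIm_neq0 v : v != 0 ->
  (map_mx (@complex.Re R) v != 0) || (map_mx (@complex.Im R) v != 0).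
Proof.
apply: contraNT; rewrite negb_or !negbK => /andP[/eqP/rowP hx /eqP/rowP hy].
apply/eqP/rowP => k; have := hx k; have := hy k; rewrite !mxE.
by case: (v 0 k) => a b /= -> ->.
Qed.

Lemma qform0 M : qform M 0 = 0.
Proof. by rewrite /qform !mul0mx mxE. Qed.

Lemma qform_sum_gt0 N (x y : 'rV[R]_d) : (forall x, x != 0 -> 0 < qform N x) ->
  (x != 0) || (y != 0) -> 0 < qform N x + qform N y.
Proof.
move=> Np; have [->|x0] := eqVneq x 0; have [->|y0] := eqVneq y 0 => //= _.
- by rewrite qform0 add0r Np.
- by rewrite qform0 addr0 Np.
- by rewrite addr_gt0 ?Np.
Qed.

Lemma qform_cplx_gt0 N v : N^T = N -> (forall x, x != 0 -> 0 < qform N x) ->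
  v != 0 -> 0 < (v *m cplx N *m adj v) 0 0.
Proof.
by move=> NT Np /ReIm_neq0 v0; rewrite qform_cplx // ltcR qform_sum_gt0.
Qed.

(** Sylvester's law of inertia in the form needed: the sign of q_H is governed by the eigenvalues of
    H S. The change of basis stays complex, so squared moduli of coordinates appear. *)
Lemma qform_diagonalization H S : H^T = H -> S^T = S ->
  (forall x, x != 0 -> 0 < qform S x) ->
  exists (Q : 'M[R[i]]_d) (m : 'rV[R]_d), [/\ Q \in unitmx,
    forall k, eigenvalue (H *m S) (m 0 k) &
    forall x, qform H x = \sum_k m 0 k * absc ((cplx x *m Q) 0 k) ^+ 2].
Proof.
move=> HT ST Sp; have [Q [m [Qu HE mreal meig]]] := simultaneous_diagonalization
  (cplx_hermsym HT) (cplx_hermsym ST) (fun v => @qform_cplx_gt0 S v ST Sp).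
exists Q, (map_mx (@complex.Re R) m); split=> // [k|x].
  by rewrite -(eigenvalue_map (real_complex R)) map_mxM mxE /= RRe_real.
apply: (@complexI R).
have -> : (qform H x)%:C = (cplx x *m cplx H *m adj (cplx x)) 0 0.
  by rewrite adj_cplx -!map_mxM mxE.
rewrite HE; set u := cplx x *m Q.
have -> : cplx x *m (Q *m diag_mx m *m adj Q) *m adj (cplx x) =
    u *m diag_mx m *m adj u by rewrite adjM !mulmxA.
clearbody u; rewrite mxE rmorph_sum; apply: eq_bigr => k _.
rewrite mul_mx_diag !mxE rmorphM rmorphXn /= RRe_real // -normr_absc.
by rewrite normCK; ring.
Qed.

Lemma qform_gt0 H S : H^T = H -> S^T = S -> (forall x, x != 0 -> 0 < qform S x) ->
  (forall l, eigenvalue (H *m S) l -> 0 < l) -> forall x, x != 0 -> 0 < qform H x.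
Proof.
move=> HT ST Sp pos x x0; have [Q [m [Qu meig ->]]] := qform_diagonalization HT ST Sp.
have [k uk] : exists k, (cplx x *m Q) 0 k != 0.
  have : cplx x *m Q != 0.
    apply: contra x0 => /eqP/(congr1 (mulmx^~ (invmx Q))).
    rewrite mulmxK // mul0mx => /rowP xk; apply/eqP/rowP => k.
    by have := xk k; rewrite !mxE => /complexI.
  by case/rV0Pn => k; exists k.
rewrite (bigD1 k) //= ltr_pwDl //.
  by apply: mulr_gt0; [exact/pos|rewrite exprn_gt0 // absc_gt0].
by apply: sumr_ge0 => j _; rewrite mulr_ge0 ?sqr_ge0 // ltW //; exact/pos.
Qed.

Lemma qform_lt0_eigenvalue H S x : H^T = H -> S^T = S ->
  (forall x, x != 0 -> 0 < qform S x) ->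
  qform H x < 0 -> exists2 l, eigenvalue (H *m S) l & l < 0.
Proof.
move=> HT ST Sp; have [Q [m [Qu meig ->]]] := qform_diagonalization HT ST Sp.
move=> neg; apply: contrapT => h; move: neg; apply/negP; rewrite -leNgt.
apply: sumr_ge0 => k _; rewrite mulr_ge0 ?sqr_ge0 // leNgt; apply/negP => mk.
by apply: h; exists (m 0 k).
Qed.

Lemma qform1_gt0 x : x != 0 -> 0 < qform 1%:M x.
Proof.
move=> /rV0Pn[k xk]; rewrite /qform mulmx1 mxE (bigD1 k) //= ltr_pwDl //.
  by rewrite mxE -expr2 exprn_even_gt0.
by apply: sumr_ge0 => j _; rewrite mxE -expr2 sqr_ge0.
Qed.

(** The case S = 1 of the diagonalization; the positive eigenvalue is obtained from -H. *)
Lemma saddle_qform H : H^T = H ->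
  (saddle H <-> (exists x, 0 < qform H x) /\ (exists x, qform H x < 0)).
Proof.
move=> HT.
have eig (M : 'M[R]_d) l : eigenvalue M l ->
    exists2 x, qform M x = l * qform 1%:M x & x != 0.
  move=> /eigenvalueP[x xM x0]; exists x => //.
  by rewrite /qform xM mulmx1 -scalemxAl mxE.
split=> [[[a [/eig[x xE x0] a0]] [b [/eig[y yE y0] b0]]]|[[x hx] [y hy]]].
  split; [exists x|exists y].
    by rewrite xE mulr_gt0 ?qform1_gt0.
  by rewrite yE nmulr_rlt0 ?qform1_gt0.
split; last first.
  have [b] := qform_lt0_eigenvalue HT (trmx1 _ _) qform1_gt0 hy.
  by rewrite mulmx1; exists b.
have HT' : (- H)^T = - H by rewrite linearN /= HT.
have hx' : qform (- H) x < 0.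
  by move: hx; rewrite /qform mulmxN mulNmx [X in _ -> X < 0]mxE oppr_lt0.
have [b] := qform_lt0_eigenvalue HT' (trmx1 _ _) qform1_gt0 hx'.
rewrite mulmx1 => /eigenvalueP[v vH v0] b0; exists (- b).
rewrite oppr_gt0; split => //; apply/eigenvalueP; exists v => //.
by rewrite scaleNr -vH mulmxN opprK.
Qed.

(** * Eigenvalues of 1 - (1/2) H S *)

Section Iteration.
Variables (H S N : 'M[R]_d).
Hypotheses (HT : H^T = H) (ST : S^T = S) (NT : N^T = N) (SN : S *m N = 1%:M).
Hypothesis Npos : forall x, x != 0 -> 0 < qform N x.
(* In the application y is x multiplied by the imaginary unit; then
   qform H x + qform H y is four times the form of the mixed Hessian, because
   the pluriharmonic part of the Hessian changes sign. *)
Hypothesis partner : forall x, x != 0 ->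
  exists2 y, y != 0 & 0 <= qform H x + qform H y < 4 * qform N x.
Let L : 'M[R]_d := 1%:M - 2^-1 *: (H *m S).

(** One has q_S(x) = q_N(x S), and x |-> x S is injective. *)
Lemma qform_inv_gt0 x : x != 0 -> 0 < qform S x.
Proof.
move=> x0; have -> : qform S x = qform N (x *m S).
  by rewrite /qform trmx_mul ST !mulmxA -[in RHS](mulmxA x) SN mulmx1.
apply: Npos; apply: contra x0 => /eqP xS0.
by rewrite -[x]mulmx1 -SN mulmxA xS0 mul0mx.
Qed.

Lemma complex_eigenvalueL a :
  complex_eigenvalue L a <-> eigenvalue (cplx (H *m S)) (2 * (1 - a)).
Proof.
have two : 2 * (2^-1 : R[i]) = 1 by rewrite mulfV.
have LE v : v *m cplx L = v - 2^-1 *: (v *m cplx (H *m S)).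
  rewrite /L map_mxB map_mx1 map_mxZ mulmxBr mulmx1 -scalemxAr.
  by congr (_ - _ *: _); rewrite /= fmorphV rmorph_nat.
split=> /eigenvalueP[v vE v0]; apply/eigenvalueP; exists v => //.
  have : 2^-1 *: (v *m cplx (H *m S)) = (1 - a) *: v.
    by rewrite scalerBl scale1r -vE LE subKr.
  by move=> /(congr1 ( *:%R 2)); rewrite !scalerA two scale1r.
by rewrite LE vE scalerA mulrA mulVf // mul1r scalerBl scale1r subKr.
Qed.

Lemma eigenvalue_quotient l : eigenvalue (cplx (H *m S)) l ->
  exists x y : 'rV[R]_d, exists r : R, [/\ (x != 0) || (y != 0), l = r%:C &
    qform H x + qform H y = r * (qform N x + qform N y)].
Proof.
move=> /eigenvalueP[v vE v0]; have xy0 := ReIm_neq0 v0.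
have vH : v *m cplx H = l *: (v *m cplx N).
  rewrite scalemxAl -vE -mulmxA -map_mxM -mulmxA SN mulmx1 //.
have := congr1 (fun u => (u *m adj v) 0 0) vH; rewrite -scalemxAl [RHS]mxE.
rewrite !qform_cplx //; set h := _ + _; set q := _ + _ => hq.
have q0 : 0 < q by exact: qform_sum_gt0.
have lE : l = (h / q)%:C.
  rewrite rmorphM fmorphV /= hq mulfK //.
  by apply/eqP => /(@complexI R) /eqP; rewrite gt_eqF.
exists (map_mx (@complex.Re R) v), (map_mx (@complex.Im R) v), (h / q).
by split=> //; rewrite divfK ?gt_eqF.
Qed.

Lemma real_eigenvalueL l : eigenvalue (H *m S) l ->
  complex_eigenvalue L (1 - l / 2)%:C.
Proof.
move=> hl; apply/complex_eigenvalueL.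
have -> : 2 * (1 - (1 - l / 2)%:C) = l%:C.
  rewrite -[in 1 - _](rmorph1 (real_complex R)) -rmorphB /=.
  by rewrite -(rmorph_nat (real_complex R)) -rmorphM /=; congr (_%:C); field.
by rewrite eigenvalue_map.
Qed.

Lemma eigenvalue_of_double (a : R[i]) (r : R) : 2 * (1 - a) = r%:C ->
  a = (1 - r / 2)%:C.
Proof.
move=> rE; rewrite rmorphB rmorph1 rmorphM fmorphV rmorph_nat /= -rE.
by rewrite [2 * _]mulrC mulfK ?subKr // pnatr_eq0.
Qed.

Lemma strictly_stable_posdef : strictly_stable L <-> posdef H.
Proof.
split=> [stab|Hpos a /complex_eigenvalueL/eigenvalue_quotient].
  apply: (qform_gt0 HT ST qform_inv_gt0) => l /real_eigenvalueL/stab.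
  by rewrite normr_absc absc_real ltcR ltr_norml => /andP[_]; lra.
move=> [x [y [r [xy0 rE hq]]]].
have aE := eigenvalue_of_double rE.
rewrite aE normr_absc absc_real ltcR ltr_norml.
have qN := qform_sum_gt0 Npos xy0.
have r0 : 0 < r.
  by have := qform_sum_gt0 Hpos xy0; rewrite -/(qform H x) hq pmulr_lgt0.
have H4 z : qform H z <= 4 * qform N z /\ (z != 0 -> qform H z < 4 * qform N z).
  have [->|z0] := eqVneq z 0; first by rewrite !qform0 mulr0.
  have [u u0 /andP[_ hu]] := partner z0; have := Hpos u u0.
  by rewrite -/(qform H u) => ?; split; [|move=> _]; lra.
have : qform H x + qform H y < 4 * (qform N x + qform N y).
  have [h1 h1'] := H4 x; have [h2 h2'] := H4 y.
  by case/orP: xy0 => [/h1'|/h2'] h; lra.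
by rewrite hq ltr_pM2r // => r4; apply/andP; split; lra.
Qed.

Lemma repulsive_saddle : has_repulsive_directions L <-> saddle H.
Proof.
rewrite saddle_qform //; split=> [[a [/complex_eigenvalueL/eigenvalue_quotient]]|].
  move=> [x [y [r [xy0 rE hq]]]].
  have aE := eigenvalue_of_double rE.
  rewrite aE normr_absc absc_real ltcR => a1.
  have qN := qform_sum_gt0 Npos xy0.
  (* The partner supplies the opposite sign: a negative value forces a positive one, and a value
     above 4 q_N forces a negative one. *)
  have H0 z : z != 0 -> qform H z < 0 -> exists u, 0 < qform H u.
    by move=> /partner[u u0 /andP[hu _]] hz; exists u; lra.
  have H4 z : z != 0 -> 4 * qform N z < qform H z -> exists u, qform H u < 0.
    by move=> /partner[u u0 /andP[_ hu]] hz; exists u; lra.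
  have nz z : qform H z != 0 -> z != 0.
    by apply: contra => /eqP->; rewrite qform0.
  have [r0|r0] := ltP r 0.
    have neg : qform H x + qform H y < 0 by rewrite hq nmulr_rlt0.
    have [z hz] : exists z, qform H z < 0.
      have [hx|hx] := ltP (qform H x) 0; first by exists x.
      by exists y; lra.
    by split; [apply: (H0 z) => //; rewrite nz // lt_eqF|exists z].
  have r4 : 4 < r.
    move: a1; rewrite [X in is_true X]ltNge ler_norml => /negP h; rewrite ltNge; apply/negP => r4.
    by apply: h; apply/andP; split; lra.
  have big : 4 * (qform N x + qform N y) < qform H x + qform H y.
    by rewrite hq ltr_pM2r.
  have [z hz z0] : exists2 z, 4 * qform N z < qform H z & z != 0.
    have [hx|hx] := ltP (4 * qform N x) (qform H x).
      exists x => //; apply: contraTneq hx => ->.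
      by rewrite !qform0 mulr0 ltxx.
    exists y; first by lra.
    by apply/eqP => y0; move: big; rewrite y0 !qform0; lra.
  split; last exact: (H4 z).
  by exists z; have := Npos z0; lra.
(* A negative value of q_H gives an eigenvalue l < 0 of H S, hence 1 - l / 2 > 1. *)
move=> [_ [x hx]]; have [l /real_eigenvalueL le l0] :=
  qform_lt0_eigenvalue HT ST qform_inv_gt0 hx.
exists (1 - l / 2)%:C; split => //.
by rewrite normr_absc absc_real ltcR gtr0_norm; lra.
Qed.

Lemma not_negdef : (0 < d)%N -> ~ negdef H.
Proof.
move=> d0 Hneg.
have x0 : (const_mx 1 : 'rV[R]_d) != 0.
  by apply/rV0Pn; exists (Ordinal d0); rewrite mxE oner_eq0.
have [y y0 /andP[h _]] := partner x0.
have := Hneg _ x0; have := Hneg _ y0; rewrite -/(qform H _) -/(qform H _).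
by move: h; lra.
Qed.

End Iteration.
End Signature.

(** * The mixed Newton iteration *)

Section Realification.
Context {R : realType} {n : nat}.
Implicit Types (u v : 'rV[R]_(n + n)) (w : 'cV[R[i]]_n) (A B : 'M[R[i]]_n).

Definition realmat A : 'M[R]_(n + n) :=
  \matrix_k to_real (A *m of_real (delta_mx 0 k)).

Lemma realmatE A u : to_real (A *m of_real u) = u *m realmat A.
Proof.
rewrite /realmat -(real_linear_mulmx (phi := fun u => to_real (A *m of_real u))) //.
  by move=> x y; rewrite of_realD mulmxDr to_realD.
by move=> a x; rewrite of_realZ -scalemxAr to_realZ.
Qed.

Definition sesq A w w' : R[i] := \sum_k conjc (w k 0) * (A *m w') k 0.

Lemma sesqD A B w w' : sesq (A + B) w w' = sesq A w w' + sesq B w w'.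
Proof.
by rewrite -big_split; apply: eq_bigr => k _; rewrite mulmxDl mxE mulrDr.
Qed.

Lemma sesq_realmat A u v :
  (u *m realmat A *m v^T) 0 0 = complex.Re (sesq A (of_real v) (of_real u)).
Proof.
rewrite -realmatE -[v in v^T]to_realK to_real_pairing -[LHS]Re_conj.
congr complex.Re; rewrite rmorph_sum; apply: eq_bigr => k _.
by rewrite rmorphM /= conjcK mulrC.
Qed.

Lemma sesqC A w w' : A \is hermsymmx -> conjc (sesq A w w') = sesq A w' w.
Proof.
move=> /is_hermitianmxP; rewrite expr0 scale1r => AE.
have Akl k l : A k l = conjc (A l k) by rewrite {1}AE !mxE.
rewrite rmorph_sum /sesq; under eq_bigr do rewrite rmorphM /= conjcK mxE rmorph_sum mulr_sumr.
rewrite exchange_big; apply: eq_bigr => l _; rewrite mxE mulr_sumr.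
by apply: eq_bigr => k _; rewrite rmorphM /= -Akl; ring.
Qed.

Lemma realmat_sym A : A \is hermsymmx -> (realmat A)^T = realmat A.
Proof.
move=> hA; apply/matrixP => k l; rewrite mxE.
have entry (M : 'M[R]_(n + n)) a b : M a b =
    ((delta_mx 0 a : 'rV[R]_(n + n)) *m M *m (delta_mx 0 b : 'rV[R]_(n + n))^T) 0 0.
  by rewrite trmx_delta -rowE -colE !mxE.
by rewrite !entry !sesq_realmat -[LHS]Re_conj sesqC.
Qed.

Lemma sesq_adj A w : (map_mx Num.conj w^T *m A *m w) 0 0 = sesq A w w.
Proof. by rewrite -mulmxA mxE; apply: eq_bigr => k _; rewrite !mxE. Qed.

(** Real coordinates are rows acted on from the right, so the order is reversed. *)
Lemma realmatM A B : realmat (A *m B) = realmat B *m realmat A.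
Proof.
apply/row_matrixP => k; rewrite !rowE mulmxA -!realmatE.
by rewrite of_realK mulmxA.
Qed.

Lemma realmat1 : realmat 1%:M = 1%:M.
Proof. by apply/row_matrixP => k; rewrite !rowE -realmatE mul1mx to_realK mulmx1. Qed.

Lemma nv_of_real u : nv (of_real u) <= (n%:R * 2) * `|u|.
Proof.
rewrite /nv; have -> : (n%:R * 2) * `|u| = \sum_(k < n) 2 * `|u|.
  by rewrite sumr_const card_ord -[RHS]mulr_natl mulrA.
apply: ler_sum => k _; apply: le_trans (absc_le_ReIm _) _; rewrite mxE /=.
have := row_entry_le u (lshift n k); have := row_entry_le u (rshift n k); lra.
Qed.

Lemma norm_to_real_le w (B : R) : 0 <= B ->
  (forall k, absc (w k 0) <= B) -> `|to_real w| <= B.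
Proof.
move=> B0 hw; apply: row_norm_le => // i; rewrite mxE.
case: splitP => k _; rewrite mxE.
  exact: le_trans (abs_Re_le _) (hw k).
exact: le_trans (abs_Im_le _) (hw k).
Qed.

End Realification.

(** * The Newton step at a critical point *)

Section MixedNewton.
Context {R : realType} {n m : nat}.
Variable g : 'I_m -> 'cV[R[i]]_n -> R[i].
Hypothesis hg : forall j, hol (g j).
Variables (P : 'M[R[i]]_n) (z0 : 'cV[R[i]]_n).
Hypothesis Ppos : hermitian_posdef P.
Hypothesis crit : grad_zbar (sum_sq_norm g) z0 = 0.
Implicit Types (z w : 'cV[R[i]]_n).

Let f := sum_sq_norm g.
Let A z := mixed_hessian f z + P.

Lemma sesq_mixed_hessian z w :
  sesq (mixed_hessian f z) w w = (\sum_j absc (pderiv (g j) w z) ^+ 2)%:C.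
Proof.
rewrite mixed_hessianE // /sesq rmorph_sum /=.
under eq_bigr do rewrite mxE mulr_sumr.
transitivity (\sum_k \sum_l \sum_j conjc (w k 0) *
  (pderiv (g j) (delta_mx l 0) z * conjc (pderiv (g j) (delta_mx k 0) z) * w l 0)).
  apply: eq_bigr => k _; apply: eq_bigr => l _.
  by rewrite mxE /hsum mulr_suml mulr_sumr.
transitivity (\sum_j \sum_k \sum_l conjc (w k 0) *
  (pderiv (g j) (delta_mx l 0) z * conjc (pderiv (g j) (delta_mx k 0) z) * w l 0)).
  by rewrite [RHS]exchange_big; apply: eq_bigr => k _; exact: exchange_big.
apply: eq_bigr => j _.
rewrite rmorphXn /= -normr_absc sqr_normc pderiv_coord rmorph_sum /= mulr_sumr.
apply: eq_bigr => k _; rewrite mulr_suml; apply: eq_bigr => l _.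
by rewrite rmorphM /=; ring.
Qed.

(** The strictness comes from P. It makes the regularized matrix invertible everywhere and the upper
    bound in [qform_partner] strict. *)
Lemma sesq_regularized z w : w != 0 ->
  \sum_j absc (pderiv (g j) w z) ^+ 2 < complex.Re (sesq (A z) w w).
Proof.
move=> w0; have [_ /(_ w w0)] := Ppos; rewrite sesq_adj => Pw.
rewrite sesqD sesq_mixed_hessian ReD /= ltrDl.
by move: Pw; rewrite ltcE => /andP[].
Qed.

Lemma regularized_unit z : A z \in unitmx.
Proof.
rewrite unitmxE unitfE -det_tr; apply/negP => /det0P[v v0 vA].
have w0 : v^T != 0 by rewrite -(inj_eq trmx_inj) trmxK trmx0.
have Aw : A z *m v^T = 0 by rewrite -[A z]trmxK -trmx_mul vA trmx0.
have s0 : sesq (A z) v^T v^T = 0.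
  by rewrite /sesq Aw big1 // => k _; rewrite [X in _ * X]mxE mulr0.
have := sesq_regularized z w0; rewrite s0.
by apply/negP; rewrite -leNgt; apply: sumr_ge0 => j _; rewrite sqr_ge0.
Qed.

Lemma mixed_hessian_herm z : mixed_hessian f z \is hermsymmx.
Proof.
apply/is_hermitianmxP; rewrite expr0 scale1r mixed_hessianE //.
apply/matrixP => k l; rewrite !mxE.
have -> : forall a : R[i], Num.conj a = conjc a by [].
rewrite rmorph_sum; apply: eq_bigr => j _.
by rewrite rmorphM /= conjcK mulrC.
Qed.

Lemma regularized_herm z : A z \is hermsymmx.
Proof.
have [/is_hermitianmxP PE _] := Ppos; have /is_hermitianmxP ME := mixed_hessian_herm z.
apply/is_hermitianmxP; move: PE ME; rewrite expr0 !scale1r => PE ME.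
by rewrite /A linearD /= map_mxD -PE -ME.
Qed.

Let N := realmat (A z0).
Let S := realmat (invmx (A z0)).
Let H := real_hessian f z0.

Lemma SN1 : S *m N = 1%:M.
Proof. by rewrite -realmatM mulmxV ?regularized_unit // realmat1. Qed.

Lemma N_sym : N^T = N. Proof. exact/realmat_sym/regularized_herm. Qed.

Lemma S_sym : S^T = S.
Proof.
have NS : N *m S^T = 1%:M by rewrite -{1}N_sym -trmx_mul SN1 trmx1.
by rewrite -[LHS]mul1mx -SN1 -mulmxA NS mulmx1.
Qed.

Lemma of_real_neq0 (x : 'rV[R]_(n + n)) : x != 0 -> of_real x != 0.
Proof.
apply: contra => /eqP x0; rewrite -[x]to_realK x0.
by apply/eqP/rowP => k; rewrite !mxE; case: splitP => j _; rewrite !mxE.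
Qed.

Lemma qform_N_gt (x : 'rV[R]_(n + n)) : x != 0 ->
  \sum_j absc (pderiv (g j) (of_real x) z0) ^+ 2 < qform N x.
Proof.
by move=> /of_real_neq0 x0; rewrite /qform sesq_realmat sesq_regularized.
Qed.

(** Replacing w by i w multiplies the second derivative of g_j along w by i^2 = -1 and leaves the
    squared modulus of the first unchanged. *)
Lemma hess_form_i w : hess_form g z0 w w + hess_form g z0 ('i *: w) ('i *: w) =
  4 * \sum_j absc (pderiv (g j) w z0) ^+ 2.
Proof.
rewrite -mulrDr -ReD -big_split /=.
have -> : (\sum_j absc (pderiv (g j) w z0) ^+ 2) =
    complex.Re (\sum_j (absc (pderiv (g j) w z0) ^+ 2)%:C).
  by rewrite -rmorph_sum.
rewrite (_ : 4 = 2 * 2 :> R); last by ring.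
rewrite -mulrA; congr (2 * _); have -> : forall a : R[i], 2 * complex.Re a = complex.Re (2 * a).
  by move=> a; rewrite ReM /= addr0 mul0r subr0.
congr complex.Re; rewrite mulr_sumr; apply: eq_bigr => j _.
rewrite rmorphXn /= -normr_absc sqr_normc pderivZw (pderivC w _ z0 (hg j)) !pderivZw conj_iM.
have i2 : ('i : R[i]) * 'i = -1 by rewrite -expr2; exact: sqr_i.
set p := pderiv _ _ _; set q := pderiv (g j) w z0; set c := conjc _.
have -> : p * c + q * conjc q + ('i * ('i * p) * c + 'i * q * (- 'i * conjc q)) =
  p * c * (1 + 'i * 'i) + q * conjc q * (1 - 'i * 'i) by ring.
by rewrite i2; ring.
Qed.

Lemma qform_partner (x : 'rV[R]_(n + n)) : x != 0 ->
  exists2 y, y != 0 & 0 <= qform H x + qform H y < 4 * qform N x.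
Proof.
move=> x0; have w0 := of_real_neq0 x0.
exists (to_real ('i *: of_real x)).
  apply: contra w0 => /eqP/(congr1 (@of_real R n)); rewrite of_realK => h.
  have : 'i *: of_real x = 0 by rewrite h; apply/matrixP => k j; rewrite !mxE; apply: complexP.
  by move/eqP; rewrite scaler_eq0 (negPf (neq0Ci _)).
rewrite /qform !real_hessian_form // of_realK hess_form_i.
rewrite -/(qform N x) ltr_pM2l // qform_N_gt // andbT.
by rewrite mulr_ge0 // sumr_ge0 // => j _; rewrite sqr_ge0.
Qed.

Lemma qform_N_gt0 (x : 'rV[R]_(n + n)) : x != 0 -> 0 < qform N x.
Proof.
move=> /qform_N_gt; apply: le_lt_trans.
by rewrite sumr_ge0 // => j _; rewrite sqr_ge0.
Qed.

Let T := newton_step P f.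
Let lin_newton w : 'cV[R[i]]_n := w - invmx (A z0) *m lin_grad g z0 w.

Lemma lip_at_hsum p (q r : 'I_p -> 'cV[R[i]]_n -> R[i]) :
  (forall j, hol (q j)) -> (forall j, hol (r j)) -> lip_at z0 (hsum q r).
Proof.
move=> hq hr; apply: lip_at_sum => j; apply: lip_atM; first exact: hol_lip_at.
exact/lip_at_conj/hol_lip_at.
Qed.

Lemma newton_second_order k :
  second_order_at z0 (fun z => T z k 0) (fun w => lin_newton w k 0).
Proof.
apply: (@second_order_at_ext R n z0 _ (fun z => z k 0 + - \sum_(l < n)
    (invmx (A z) k l * hsum g (fun j => pderiv (g j) (delta_mx l 0)) z))
  _ (fun w => w k 0 + - \sum_(l < n) (invmx (A z0) k l * lin_grad g z0 w l 0))).
- move=> z; rewrite !mxE; congr (_ - _); apply: eq_bigr => l _.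
  by rewrite grad_zbarE // mxE.
- by move=> w; rewrite !mxE.
apply: second_order_atD; first by apply: second_order_at_linear => z h; rewrite mxE.
apply: second_order_atN; apply: second_order_at_sum => l.
have hp j := hol_pderiv (delta_mx l 0) (hg j).
(* F is an entry of the inverse matrix, for which a Lipschitz bound is enough; G is a gradient
   component, zero at z0 by criticality. *)
apply: second_order_at_vanishing.
- apply: lip_at_invmx => [z|a b]; first exact: regularized_unit.
  rewrite (_ : (fun z => A z a b) = fun z => hsum (fun j => pderiv (g j) (delta_mx b 0))
     (fun j => pderiv (g j) (delta_mx a 0)) z + P a b); last first.
    by apply: funext => z; rewrite mxE mixed_hessianE // mxE.
  by apply: lip_atD (lip_at_cst _ _); apply: lip_at_hsum => j; exact: hol_pderiv.
- exact: lip_at_hsum.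
- by have /matrixP/(_ l 0) := crit; rewrite grad_zbarE // !mxE.
- rewrite (_ : (fun w => lin_grad g z0 w l 0) = fun w => \sum_j
    (pderiv (g j) w z0 * conjc (pderiv (g j) (delta_mx l 0) z0)
   + g j z0 * conjc (pderiv (pderiv (g j) (delta_mx l 0)) w z0))); last first.
    by apply: funext => w; rewrite mxE.
  apply: second_order_at_sum => j.
  apply: second_order_atM.
  + exact: hol_lip_at.
  + exact/lip_at_conj/hol_lip_at.
  + exact: hol_second_order_at.
  + exact/second_order_at_conj/hol_second_order_at.
Qed.

Lemma newton_fixed : T z0 = z0.
Proof. by rewrite /T /newton_step crit mulmx0 subr0. Qed.

Let L : 'M[R]_(n + n) := 1%:M - 2^-1 *: (H *m S).

Lemma lin_newton_real (u : 'rV[R]_(n + n)) : to_real (lin_newton (of_real u)) = u *m L.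
Proof.
rewrite to_realD to_realN to_realK -[lin_grad _ _ _]of_realK realmatE.
by rewrite to_real_lin_grad // /L mulmxBr mulmx1 -scalemxAl -scalemxAr mulmxA.
Qed.

Lemma newton_real_second_order : exists C r : R, 0 < r /\
  forall u : 'rV[R]_(n + n), `|u| < r ->
    `|in_real_coords T (to_real z0 + u) - to_real z0 - u *m L| <= C * `|u| ^+ 2.
Proof.
have [C [r [C0 r0 hT]]] := second_order_at_common newton_second_order.
have fixT := newton_fixed; have linE := lin_newton_real; clearbody T lin_newton.
(* c compares the sum norm on C^n with the maximum norm on rows; its square enters through the
   quadratic remainder. *)
pose c : R := n%:R * 2; have c0 : 0 <= c by rewrite mulr_ge0.
exists (C * c ^+ 2), (r / (c + 1)); split; first by rewrite divr_gt0 // ltr_wpDl.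
move=> u ur.
rewrite /in_real_coords of_realD of_realK -linE -!to_realN -!to_realD.
have cu : nv (of_real u) <= c * `|u| := nv_of_real u.
apply: norm_to_real_le => [|k].
  by rewrite mulr_ge0 ?sqr_ge0 // mulr_ge0 ?sqr_ge0.
have ru : nv (of_real u) <= r.
  apply: le_trans cu _; apply: le_trans (small_quotient c0 r0).
  by rewrite ler_wpM2l // ltW.
have := hT k _ ru; rewrite fixT !mxE => /le_trans; apply.
by rewrite -mulrA ler_wpM2l // -exprMn ler_sqr ?nnegrE ?nv_ge0 // mulr_ge0.
Qed.

Lemma newton_differentiable :
  differentiable (in_real_coords T) (to_real z0) /\ linearization T z0 = L.
Proof.
have [C [r [r0 h]]] := newton_real_second_order.
apply: (@quadratic_remainder_jacobian _ _ _ (in_real_coords T) (to_real z0) L C r r0).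
move=> u /h; rewrite [in_real_coords T (to_real z0)]/in_real_coords.
by rewrite of_realK newton_fixed.
Qed.

Lemma newton_second_order_linearization : second_order_linearization T z0 L.
Proof.
have [C [r [r0 h]]] := newton_real_second_order; exists C.
apply/nbhs_normP; exists r => // u /= ur.
have := h (u - to_real z0); rewrite subrKC; apply.
by rewrite distrC.
Qed.

End MixedNewton.

(** The first two conclusions certify that [linearization] is a genuine derivative with the
    quadratic expansion, as ['J] has a value in all cases. *)
Theorem theorem2 (R : realType) (n m : nat) (n_ge1 : (1 <= n)%N) (m_ge1 : (1 <= m)%N)
    (g : 'I_m -> 'cV[R[i]]_n -> R[i]) (g_hol : forall j : 'I_m, holomorphic (g j))
    (P : 'M[R[i]]_n) (P_posdef : hermitian_posdef P)
    (zhat : 'cV[R[i]]_n) (zhat_crit : grad_zbar (sum_sq_norm g) zhat = 0) :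
  let f := sum_sq_norm g in
  let T := newton_step P f in
  let H := real_hessian f zhat in
  let L := linearization T zhat in
  [/\ differentiable (in_real_coords T) (to_real zhat),
      second_order_linearization T zhat L,
      strictly_stable L <-> posdef H,
      has_repulsive_directions L <-> saddle H
    & ~ negdef H].
Proof.
move=> f T H L.
have hg j : hol (g j) := holomorphic_hol (g_hol j).
have [dT LE] := newton_differentiable hg P_posdef zhat_crit.
have HT : H^T = H := real_hessian_sym hg zhat.
have ST := S_sym hg zhat P_posdef; have NT := N_sym hg zhat P_posdef.
have SN := SN1 hg zhat P_posdef.
have Np := qform_N_gt0 hg zhat P_posdef; have part := qform_partner hg zhat P_posdef.
have d0 : (0 < n + n)%N by rewrite addn_gt0 n_ge1.
(* With L identified as 1 - (1/2) H S, the spectral claims are linear algebra on H, S and N. *)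
rewrite /L LE; split => //.
- exact: newton_second_order_linearization.
- exact: (strictly_stable_posdef HT ST NT SN Np part).
- exact: (repulsive_saddle HT ST NT SN Np part).
- exact: not_negdef part d0.
Qed.
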